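(* Let $0<b\le a$ be fixed and $t>0$. For integers $1\le m\le n$ let $\Omega_{m,n,[b^2,a^2]}$ be the set of all weight functions $\omega:\{1,\dots,m\}\times\{1,\dots,n\}\to[b^2,a^2]$, and for such $\omega$ let $K_{m,n,\omega}$ be the complete bipartite graph with parts of sizes $m$ and $n$ weighted by $\omega$. Let $C(\omega)=[\sqrt{\omega(i,j)}]\in\mathbb{R}^{m\times n}$ and $A=A(\omega)=\begin{pmatrix}0&C(\omega)\\-C(\omega)^\top&0\end{pmatrix}\in\mathbb{R}^{N\times N}$, $N=m+n$. Let $x_{ij}$, $1\le i\le j\le N$, be independent real Gaussian random variables with mean $0$ and variance $1$, $Y_A=[a_{ij}x_{\min(i,j)\max(i,j)}]_{i,j=1}^N$, and define $\tilde\Phi(t,K_{m,n,\omega})$ by $\log\tilde\Phi(t,K_{m,n,\omega})=\mathbb{E}\log\det(\sqrt tI_N+Y_A)$. Then for every $\delta>0$, $$\limsup_{n\to\infty}\ \sup_{m\le n,\ \omega\in\Omega_{m,n,[b^2,a^2]}}\Pr\Big(\frac{1}{m+n}\big|\log\det(\sqrt tI_N+Y_A)-\log\Phi(t,K_{m,n,\omega})\big|>\delta\Big)=0,$$ and equivalently $$\limsup_{n\to\infty}\ \sup_{m\le n,\ \omega\in\Omega_{m,n,[b^2,a^2]}}\frac{1}{m+n}\Big(\log\Phi(t,K_{m,n,\omega})-\log\tilde\Phi(t,K_{m,n,\omega})\Big)=0.$$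
   Context: For a weighted graph $G_\omega$ on $N$ vertices: a $k$-matching is a set of $k$ pairwise vertex-disjoint edges; $\phi(k,G_\omega)=\sum_M\prod_{e\in M}\omega(e)$ over all $k$-matchings $M$ (zero if none), $\phi(0,G_\omega)=1$; $\Phi(t,G_\omega)=\sum_{k=0}^{n'}\phi(k,G_\omega)t^{n'-k}$ with $n'=\lfloor N/2\rfloor$. *)

(* Defs.v *)
From HB Require Import structures.
From mathcomp Require Import all_boot all_order all_algebra.
From mathcomp Require Import all_classical all_reals all_analysis.
Set Implicit Arguments. Unset Strict Implicit. Unset Printing Implicit Defensive.
Import Order.TTheory GRing.Theory Num.Theory.
Local Open Scope ring_scope.

Record wgraph (R : Type) (N : nat) := WGraph {
  wg_edges : {set {set 'I_N}};
  wg_weight : {set 'I_N} -> R }.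

Definition is_kmatching (R : Type) (N : nat) (G : wgraph R N) (k : nat)
    (M : {set {set 'I_N}}) : bool :=
  [&& M \subset wg_edges G, #|M| == k &
      [forall e in M, forall f in M, (e != f) ==> [disjoint e & f]]].

Definition phi_match (R : comPzRingType) (N : nat) (k : nat) (G : wgraph R N) : R :=
  \sum_(M : {set {set 'I_N}} | is_kmatching G k M) \prod_(e in M) wg_weight G e.

Definition Phi_match (R : comPzRingType) (N : nat) (t : R) (G : wgraph R N) : R :=
  \sum_(k < N./2.+1) phi_match k G * t ^+ (N./2 - k).

(* The weighted complete bipartite graph K_{m,n,omega} on 'I_(m+n):
   vertex i : 'I_m is lshift n i, vertex j : 'I_n is rshift m j;
   the edge {i, j} has weight omega i j. *)
Definition Kbip (R : comPzRingType) (m n : nat) (omega : 'I_m -> 'I_n -> R) :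
    wgraph R (m + n) :=
  WGraph [set [set lshift n i; rshift m j] | i : 'I_m, j : 'I_n]
    (fun e => \sum_(i : 'I_m) \sum_(j : 'I_n)
                if e == [set lshift n i; rshift m j] then omega i j else 0).

Definition Cmat (R : rcfType) (m n : nat) (omega : 'I_m -> 'I_n -> R) : 'M[R]_(m, n) :=
  \matrix_(i, j) Num.sqrt (omega i j).

Definition Amat (R : rcfType) (m n : nat) (omega : 'I_m -> 'I_n -> R) : 'M[R]_(m + n) :=
  block_mx 0 (Cmat omega) (- (Cmat omega)^T) 0.

Definition Ymat (R : rcfType) (N : nat) (A : 'M[R]_N) (x : 'I_N -> 'I_N -> R) : 'M[R]_N :=
  \matrix_(i, j) (A i j * (if (i <= j)%N then x i j else x j i)).

Definition logdet_YA (R : realType) (m n : nat) (omega : 'I_m -> 'I_n -> R) (t : R)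
    (x : 'I_(m + n) -> 'I_(m + n) -> R) : R :=
  ln (\det ((Num.sqrt t)%:M + Ymat (Amat omega) x)).

Local Open Scope classical_set_scope.

Definition upper_pairs (N : nat) : {set 'I_N * 'I_N} :=
  [set p : 'I_N * 'I_N | (p.1 <= p.2)%N]%SET.

(* mutual independence of the finite family (X p)_{p in S}: the product rule
   for every choice of measurable sets B p (this includes all subfamilies,
   by taking B p = setT). *)
Definition mutually_independent d (T : measurableType d) (R : realType)
    (P : probability T R) (I : finType) (S : {set I}) (X : I -> T -> R) : Prop :=
  forall B : I -> set R, (forall p, measurable (B p)) ->
    P (\bigcap_(p in [set p | p \in S]) (X p @^-1` B p)) =
    (\prod_(p in S) P (X p @^-1` B p))%E.

Definition std_gaussian d (T : measurableType d) (R : realType)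
    (P : probability T R) (X : T -> R) : Prop :=
  forall B : set R, measurable B -> P (X @^-1` B) = normal_prob 0 1 B.

Definition iid_std_gaussian d (T : measurableType d) (R : realType)
    (P : probability T R) (N : nat) (x : 'I_N -> 'I_N -> {RV P >-> R}) : Prop :=
  mutually_independent P (upper_pairs N) (fun p => (x p.1 p.2 : T -> R)) /\
  forall i j : 'I_N, (i <= j)%N -> std_gaussian P (x i j).

Definition logtPhi d (T : measurableType d) (R : realType) (P : probability T R)
    (m n : nat) (omega : 'I_m -> 'I_n -> R) (t : R)
    (x : 'I_(m + n) -> 'I_(m + n) -> {RV P >-> R}) : \bar R :=
  (\int[P]_s (logdet_YA omega t (fun i j => x i j s))%:E)%E.

(* Main.v *)
Require Import Defs.
From HB Require Import structures.
From mathcomp Require Import all_boot all_order all_algebra.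
From mathcomp Require Import all_classical all_reals all_analysis.
From mathcomp Require Import measurable_realfun.
From mathcomp Require Import ring lra zify.
Set Implicit Arguments. Unset Strict Implicit. Unset Printing Implicit Defensive.
Import Order.TTheory GRing.Theory Num.Theory.
Import numFieldNormedType.Exports.
Local Open Scope classical_set_scope.
Local Open Scope ring_scope.

(**
Let m <= n, and let E be the m x n matrix with entries sqrt(omega i j / t) x_ij.
Then det(sqrt t I + Y_A) = sqrt t ^ (m+n) g with g = det(I + E^T E) >= 1, and the
vertex recursion for matchings shows that the mean of g is Phi up to a power of t.
So everything follows from ln (mean g) - mean (ln g) = o(n): the variable
U = ln g - ln (mean g) satisfies mean (e^U) = 1, whence mean |U| <= 2 - mean U, and
Markov's inequality applies.

Conditionally on the other rows, g is a constant times 1 + r H r^T, where r is the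
given row and H = (I + E0^T E0)^-1 is a contraction, E0 being E with that row zeroed.
When at most m' rows are nonzero, tr H >= n - m' + 1, so the relative variance of
this quadratic form is O(1/(n - m' + 1)), and the gap between the logarithm of the
mean and the mean of the logarithm is O(ln n / (n - m' + 1)) for each row.  Such
gaps add up over independent blocks, by Jensen's inequality for exp and Fubini.
Finally each of the last k ~ sqrt n rows multiplies the mean of g by at most O(n)
and does not decrease ln g, so they contribute at most O(k ln n).  Using the first
bound for the other rows, the total is O(n ln n / k + k ln n) = o(n).
*)

(** * Independent families and expectations *)

(** The obstacle is uniformity up to m = n. With all n rows in play only tr H >= 1 is known, and n
    gaps of order ln n would add up to n ln n. Holding back k rows leaves a trace of at least k + 1
    for the others, and k ~ sqrt n balances the two errors, both then of order sqrt n ln n. The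
    weights enter only through the bounds b / sqrt t and a / sqrt t on the coefficients of E, whence
    the uniformity in omega. No conditional expectation appears: the sample has the law of a splice
    of two independent copies, so that conditioning on some rows means freezing one factor of a
    product space. As g >= 1, its logarithm lies between 0 and g; it is integrable as soon as g is,
    and no lower tail estimate is required. Phi carries the power floor((m+n)/2) of t while the
    determinant carries sqrt t ^ (m+n): an odd m+n leaves an error |ln (sqrt t)|, harmless after
    division by m+n. The bound limsup >= 0 is Jensen's inequality, mean U <= 0, together with this
    parity term. *)

Section cylinder.
Context (R : realType) (I : finType).

Definition boxes : set (set (I -> R)) :=
  [set A | exists2 B : I -> set R, (forall p, measurable (B p)) &
     A = [set x | forall p, B p (x p)]].

(** The product sigma-algebra on [I -> R], generated by boxes so that two laws can be compared on a
    pi-system. *)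
Definition cyl : measurableType boxes.-sigma := g_sigma_algebraType boxes.

Lemma measurable_coord (p : I) : measurable_fun setT (fun x : cyl => x p : R).
Proof.
move=> _ B mB; rewrite setTI; apply: sub_sigma_algebra.
exists (fun q => if q == p then B else setT).
  by move=> q; case: ifP.
apply/seteqP; split => x /=.
  by move=> Bx q; case: eqP => [->|].
by move=> /(_ p); rewrite eqxx.
Qed.

Lemma measurable_cyl d (T : measurableType d) (f : T -> cyl) :
  (forall p, measurable_fun setT (fun s => f s p)) -> measurable_fun setT f.
Proof.
move=> mf; apply: (@measurability _ _ T (cyl) setT f boxes) => //.
move=> _ [_ [B mB ->] <-]; rewrite setTI.
rewrite (_ : _ @^-1` _ = \bigcap_(p in setT) ((fun s => f s p) @^-1` B p)).
  apply: fin_bigcap_measurable => // p _.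
  by rewrite -[_ @^-1` _]setTI; apply: mf.
apply/seteqP; split => x /=; first by move=> h p _; exact: h.
by move=> h p; exact: h.
Qed.

Lemma boxes_setI : setI_closed boxes.
Proof.
move=> _ _ [B mB ->] [C mC ->]; exists (fun p => B p `&` C p).
  by move=> p; apply: measurableI.
apply/seteqP; split => x /=; first by move=> [h1 h2] p.
by move=> h; split=> p; have [] := h p.
Qed.

Lemma boxesT : boxes setT.
Proof. by exists (fun=> setT) => //; apply/seteqP; split. Qed.

Lemma cyl_measure_unique (m1 m2 : {measure set cyl -> \bar R}) :
  (m1 setT < +oo)%E ->
  (forall A, boxes A -> m1 A = m2 A) -> forall A, measurable A -> m1 A = m2 A.
Proof.
move=> m1T m12; apply: (@measure_unique _ R cyl boxes (fun=> setT)) => //.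
- exact: boxes_setI.
- by move=> _; exact: boxesT.
- by apply/seteqP; split=> // x _; exists 0%N.
Qed.

End cylinder.

Section independence.
Context d (T : measurableType d) (R : realType) (P : probability T R).
Variables (I : finType) (X : I -> {RV P >-> R}).

Definition independent_family := forall B : I -> set R,
  (forall p, measurable (B p)) ->
  P [set s | forall p, B p (X p s)] = (\prod_p P (X p @^-1` B p))%E.

Definition sample (s : T) : cyl R I := fun p => X p s.

Definition splice (A : {set I}) (x y : cyl R I) : cyl R I :=
  fun p => if p \in A then x p else y p.

Lemma measurable_sample : measurable_fun setT sample.
Proof. by apply: measurable_cyl => p; exact: (@measurable_funPT _ _ _ _ (X p)). Qed.

Lemma measurable_splice (A : {set I}) : measurable_fun setT
  (fun z : T * T => splice A (sample z.1) (sample z.2)).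
Proof.
apply: measurable_cyl => p; rewrite /splice /sample; case: (p \in A).
- exact: (measurableT_comp (measurable_funP (X p)) measurable_fst).
- exact: (measurableT_comp (measurable_funP (X p)) measurable_snd).
Qed.

Hypothesis indX : independent_family.

(** Both laws are finite and agree on boxes: by independence the probability of a box is a product
    over its sides, which factors into the sides in [A], read on the first copy, and the others,
    read on the second. *)
Lemma law_splice (A : {set I}) (F : cyl R I -> \bar R) :
  measurable_fun setT F -> (forall x, 0 <= F x)%E ->
  (\int[P]_s F (sample s) =
   \int[P \x P]_z F (splice A (sample z.1) (sample z.2)))%E.
Proof.
move=> mF F0.
have mS := measurable_splice A; have mX := measurable_sample.
pose g (z : T * T) := splice A (sample z.1) (sample z.2).
pose mfX : {mfun T >-> cyl R I} :=
  HB.pack sample (isMeasurableFun.Build _ _ _ _ _ mX).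
pose mfS : {mfun (T * T)%type >-> cyl R I} :=
  HB.pack g (isMeasurableFun.Build _ _ _ _ _ mS).
rewrite -[RHS](@ge0_integral_pushforward _ _ _ _ _ _ mS _ setT F) //.
rewrite -[LHS](@ge0_integral_pushforward _ _ _ _ _ _ mX _ setT F) //.
transitivity (\int[pushforward P mfX]_x F x)%E; first by [].
transitivity (\int[pushforward (P \x P)%E mfS]_x F x)%E; last by [].
apply: eq_measure_integral.
move=> E mE _; apply: cyl_measure_unique => //.
  by rewrite /= /pushforward preimage_setT probability_setT ltry.
move=> _ [B mB ->]; rewrite /= /pushforward /=.
have mXB p (C : set R) : measurable C -> measurable (X p @^-1` C).
  by move=> mC; exact: (measurable_funPTI (X p)).
(* [BA] and [BC] keep the sides inside and outside [A] and are padded with the whole line, so that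
   the event on the product space is a rectangle. *)
pose BA p := if p \in A then B p else setT.
pose BC p := if p \in A then setT else B p.
have mBA p : measurable (BA p) by rewrite /BA; case: ifP.
have mBC p : measurable (BC p) by rewrite /BC; case: ifP.
have mb (C : I -> set R) : (forall p, measurable (C p)) ->
    measurable [set s | forall p, C p (X p s)].
  move=> mC; rewrite (_ : mkset _ = \bigcap_(p in setT) (X p @^-1` C p)).
    by apply: fin_bigcap_measurable => // p _; exact: mXB.
  by apply/seteqP; split => x /= h p; [move=> _|]; apply: h.
transitivity (P [set s | forall p, BA p (X p s)] * P [set s | forall p, BC p (X p s)])%E.
  rewrite (_ : _ @^-1` _ = [set s | forall p, B p (X p s)]) //.
  rewrite !indX // -big_split /=; apply: eq_bigr => p _.
  by rewrite /BA /BC; case: ifP => _; rewrite preimage_setT probability_setT ?mule1 ?mul1e.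
rewrite -product_measure1E; [|exact: mb|exact: mb].
congr ((P \x P)%E _); apply/seteqP; split => -[s s'] /=.
  move=> [h1 h2] p; rewrite /g /splice /sample /=.
  by move: (h1 p) (h2 p); rewrite /BA /BC; case: ifP.
move=> h; split => p; move: (h p); rewrite /g /splice /sample /BA /BC /=; case: ifP => //.
Qed.

Lemma law_splice_signed (A : {set I}) (F : cyl R I -> \bar R) :
  measurable_fun setT F ->
  (\int[P]_s F (sample s) =
   \int[P \x P]_z F (splice A (sample z.1) (sample z.2)))%E.
Proof.
move=> mF; rewrite integralE [RHS]integralE.
pose g (z : T * T) := splice A (sample z.1) (sample z.2).
have hp := law_splice A (measurable_funepos mF) (fun x => funepos_ge0 F x).
have hn := law_splice A (measurable_funeneg mF) (fun x => funeneg_ge0 F x).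
rewrite -[fun s => F (sample s)]/(F \o sample).
rewrite -[fun z => F (splice A _ _)]/(F \o g).
have ep := funepos_comp F; have en := funeneg_comp F.
rewrite (ep _ sample) (ep _ g) (en _ sample) (en _ g).
by congr (_ - _)%E; [exact: hp|exact: hn].
Qed.


(** Integrability and a real value in one predicate: linearity and comparison then take place in [R]
    rather than in [\bar R]. *)
Definition hasE (f : T -> R) (v : R) :=
  P.-integrable setT (EFin \o f) /\ (\int[P]_s (f s)%:E = v%:E)%E.

Lemma hasE_cst (c : R) : hasE (fun=> c) c.
Proof.
split; first exact: finite_measure_integrable_cst.
by rewrite integral_cst //= probability_setT mule1.
Qed.

Lemma hasE_unique f v w : hasE f v -> hasE f w -> v = w.
Proof. by move=> [_ h1] [_]; rewrite h1 => -[]. Qed.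

Lemma eq_hasE f g v : f =1 g -> hasE f v -> hasE g v.
Proof. by move=> /funext ->. Qed.

Lemma hasED f g v w : hasE f v -> hasE g w -> hasE (fun s => f s + g s) (v + w).
Proof.
move=> [i1 h1] [i2 h2]; split; first exact: (integrableD measurableT i1 i2).
under eq_integral do rewrite EFinD.
by rewrite (integralD measurableT i1 i2) h1 h2.
Qed.

Lemma hasEZ (k : R) f v : hasE f v -> hasE (fun s => k * f s) (k * v).
Proof.
move=> [i1 h1]; split; first exact: (integrableZl measurableT k i1).
under eq_integral do rewrite EFinM.
by rewrite (integralZl measurableT i1) h1.
Qed.

Lemma hasE_sum (J : Type) (r : seq J) (Q : pred J) (f : J -> T -> R) (v : J -> R) :
  (forall j, Q j -> hasE (f j) (v j)) ->
  hasE (fun s => \sum_(j <- r | Q j) f j s) (\sum_(j <- r | Q j) v j).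
Proof.
move=> h; elim: r => [|j r IH].
  rewrite big_nil; apply: eq_hasE (hasE_cst 0) => s; by rewrite big_nil.
rewrite big_cons; case: ifP => Qj.
  by apply: eq_hasE (hasED (h _ Qj) IH) => s; rewrite big_cons Qj.
by apply: eq_hasE IH => s; rewrite big_cons Qj.
Qed.

Lemma hasE_le f g v w : hasE f v -> hasE g w -> (forall s, f s <= g s) -> v <= w.
Proof.
move=> [i1 h1] [i2 h2] fg; rewrite -lee_fin -h1 -h2.
by apply: le_integral => // s _; rewrite lee_fin.
Qed.

Lemma hasE_ge0 (f : T -> R) (v : R) : measurable_fun setT f -> (forall s, 0 <= f s) ->
  (\int[P]_s (f s)%:E = v%:E)%E -> hasE f v.
Proof.
move=> mf f0 h; split => //; apply/integrableP; split; first exact/measurable_EFinP.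
by under eq_integral do rewrite /= ger0_norm //; rewrite h ltry.
Qed.

Lemma hasE_prod2 (f g : T -> R) (v w : R) : hasE f v -> hasE g w ->
  (P \x P)%E.-integrable setT (fun z : T * T => (f z.1 * g z.2)%:E) /\
  (\int[P \x P]_z (f z.1 * g z.2)%:E = (v * w)%:E)%E.
Proof.
move=> [i1 h1] [i2 h2].
have mf : measurable_fun setT f by apply/measurable_EFinP; exact: measurable_int i1.
have mg : measurable_fun setT g by apply/measurable_EFinP; exact: measurable_int i2.
have mfg : measurable_fun setT (fun z : T * T => (f z.1 * g z.2)%:E).
  apply/measurable_EFinP; apply: measurable_funM.
  - exact: (measurableT_comp mf measurable_fst).
  - exact: (measurableT_comp mg measurable_snd).
have ifg : (P \x P)%E.-integrable setT (fun z : T * T => (f z.1 * g z.2)%:E).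
  apply/integrable12ltyP => //=.
  have [K hK] : exists K : R, (\int[P]_s `|g s|%:E = K%:E)%E.
    have i2' := integrable_norm i2.
    exists (fine (\int[P]_s `|g s|%:E)%E); rewrite fineK //.
    exact: (integrable_fin_num measurableT i2').
  under eq_integral => x _.
    under eq_integral do rewrite normrM EFinM.
    rewrite ge0_integralZl //=; last first.
      by apply/measurable_EFinP; exact: measurableT_comp.
    rewrite hK; over.
  have i1' := integrableZr measurableT K (integrable_norm i1).
  exact: (integrable_lty measurableT i1').
split => //.
rewrite -(integral12_prod_meas1 ifg) /fubini_F /=.
under eq_integral => x _.
  under eq_integral do rewrite EFinM.
  rewrite (integralZl measurableT i2) h2; over.
by rewrite (integralZr measurableT i1) h1 EFinM.
Qed.

(** The hypotheses on [splice A] say that [F] reads only the coordinates in [A] and [G] only the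
    others; after splicing, the integrand is a product of functions of separate variables. *)
Lemma hasE_indep (A : {set I}) (F G : cyl R I -> R) (v w : R) :
  measurable_fun setT F -> measurable_fun setT G ->
  (forall x y, F (splice A x y) = F x) -> (forall x y, G (splice A x y) = G y) ->
  hasE (F \o sample) v -> hasE (G \o sample) w ->
  hasE (fun s => F (sample s) * G (sample s)) (v * w).
Proof.
move=> mF mG FA GA hF hG.
have [i h] := hasE_prod2 hF hG.
have mFG : measurable_fun setT (fun x => (F x * G x)%:E).
  by apply/measurable_EFinP; exact: measurable_funM.
have e : (\int[P]_s (F (sample s) * G (sample s))%:E = (v * w)%:E)%E.
  rewrite (law_splice_signed A mFG) -h.
  by apply: eq_integral => z _; rewrite FA GA.
split => //; apply/integrableP; split.
  exact: (measurableT_comp mFG measurable_sample).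
have mFG' : measurable_fun setT (fun x => `|(F x * G x)%:E|)%E.
  exact: measurableT_comp.
rewrite [X in (X < _)%E](law_splice A mFG') //.
move/integrableP : i => [_]; congr (_ < _)%E.
by apply: eq_integral => z _ /=; rewrite FA GA.
Qed.

Lemma hasE_monomial (mom : nat -> R) (e : I -> nat) :
  (forall p k, hasE (fun s => X p s ^+ k) (mom k)) ->
  hasE (fun s => \prod_p X p s ^+ e p) (\prod_p mom (e p)).
Proof.
move=> hm.
have mono (r : seq I) : uniq r ->
    hasE (fun s => \prod_(p <- r) X p s ^+ e p) (\prod_(p <- r) mom (e p)).
  elim: r => [_|q r IH /= /andP[qr ur]].
    by rewrite big_nil; apply: eq_hasE (hasE_cst 1) => s; rewrite big_nil.
  rewrite big_cons.
  have mc p k : measurable_fun setT (fun x : cyl R I => x p ^+ k).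
    by apply: measurable_funX; exact: measurable_coord.
  have h : hasE (fun s => X q s ^+ e q * \prod_(p <- r) X p s ^+ e p)
      (mom (e q) * \prod_(p <- r) mom (e p)).
    apply: (@hasE_indep [set q]%SET (fun x => x q ^+ e q)
      (fun x => \prod_(p <- r) x p ^+ e p)).
    - exact: mc.
    - by apply: measurable_prod => p _; exact: mc.
    - by move=> x y; rewrite /splice inE eqxx.
    - move=> x y; apply: eq_big_seq => p pr; rewrite /splice inE.
      by case: eqP => // pq; rewrite pq (negbTE qr) in pr.
    - exact: hm.
    - exact: IH.
  by apply: eq_hasE h => s; rewrite big_cons.
have := mono (index_enum I) (index_enum_uniq I); exact.
Qed.

End independence.

(** * Moments of the standard normal law *)

Section gaussian_moments.
Context (R : realType).
Local Notation mu := (@lebesgue_measure R).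

(** The change of variables is along the Radon-Nikodym derivative, which equals [normal_pdf] almost
    everywhere because both have the same integral over every measurable set. *)
Lemma ge0_integral_normal_prob (m s : R) (h : R -> R) :
  measurable_fun setT h -> (forall x, 0 <= h x) ->
  (\int[normal_prob m s]_x (h x)%:E = \int[mu]_x (h x * normal_pdf m s x)%:E)%E.
Proof.
move=> mh h0.
have dom := @normal_prob_dominates R m s.
have mhE : measurable_fun setT (fun x => (h x)%:E) by exact/measurable_EFinP.
rewrite -(Radon_Nikodym_SigmaFinite.change_of_variables dom) //.
have fi := Radon_Nikodym_SigmaFinite.f_integrable dom.
have mpdf : measurable_fun setT (fun x => (normal_pdf m s x)%:E).
  by apply/measurable_EFinP; exact: measurable_normal_pdf.
under [RHS]eq_integral do rewrite EFinM.
apply: ae_eq_integral => //.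
- by apply: emeasurable_funM => //; exact: measurable_int fi.
- exact: emeasurable_funM.
apply: ae_eqe_mul2l; apply: integral_ae_eq => //.
by move=> E _ mE; rewrite -Radon_Nikodym_SigmaFinite.f_integral.
Qed.

(** Completing the square turns the tilted density into a multiple of the normal density of mean
    l. *)
Lemma integral_expR_normal (l : R) :
  (\int[normal_prob (0:R) 1]_x (expR (l * x))%:E = (expR (l ^+ 2 / 2))%:E)%E.
Proof.
rewrite ge0_integral_normal_prob; last 2 first.
- by apply: measurableT_comp => //; exact: measurable_funM.
- by move=> x; exact: expR_ge0.
have e x : expR (l * x) * normal_pdf 0 1 x = expR (l ^+ 2 / 2) * normal_pdf l 1 x.
  rewrite !normal_pdfE ?oner_eq0 // /normal_fun mulrCA [RHS]mulrCA -!expRD.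
  by congr (_ * expR _); rewrite subr0 expr1n; field.
under eq_integral do rewrite e EFinM.
rewrite ge0_integralZl //; first by rewrite integral_normal_pdf mule1.
- by apply/measurable_EFinP; exact: measurable_normal_pdf.
- by move=> x _; rewrite lee_fin normal_pdf_ge0.
Qed.

(** The exponent is parametrized so that the tilted density is s times the normal density of
    standard deviation s. *)
Lemma integral_expR_sqr_normal (s : R) : 0 < s ->
  (\int[normal_prob (0:R) 1]_x (expR ((1 - s^-2) / 2 * x ^+ 2))%:E = s%:E)%E.
Proof.
move=> s0; have sn0 : s != 0 by rewrite gt_eqF.
rewrite ge0_integral_normal_prob; last 2 first.
- apply: measurableT_comp => //; apply: measurable_funM => //; exact: measurable_funX.
- by move=> x; exact: expR_ge0.
have e x : expR ((1 - s^-2) / 2 * x ^+ 2) * normal_pdf 0 1 x = s * normal_pdf 0 s x.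
  rewrite !normal_pdfE ?oner_eq0 // /normal_fun mulrCA -!expRD.
  rewrite [RHS]mulrA; congr (_ * expR _).
    rewrite /normal_peak expr1n mul1r -[s ^+ 2 * pi *+ 2]mulrnAr sqrtrM ?sqr_ge0 //.
    by rewrite sqrtr_sqr gtr0_norm // invfM mulrA divff // mul1r.
  by rewrite !subr0 expr1n; field.
under eq_integral do rewrite e EFinM.
rewrite ge0_integralZl //; first by rewrite integral_normal_pdf mule1.
- by apply/measurable_EFinP; exact: measurable_normal_pdf.
- by move=> x _; rewrite lee_fin normal_pdf_ge0.
- by rewrite lee_fin ltW.
Qed.

(** |x|^k is at most k! (e^x + e^(-x)), which has finite mean. *)
Lemma exists_gauss_moment (k : nat) : exists M : R,
  (normal_prob (0:R) 1).-integrable setT (fun x : R => (x ^+ k)%:E) /\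
  (\int[normal_prob (0:R) 1]_x (x ^+ k)%:E = M%:E)%E.
Proof.
have mk : measurable_fun setT (fun x : R => (x ^+ k)%:E).
  by apply/measurable_EFinP; exact: measurable_funX.
suff i : (normal_prob (0:R) 1).-integrable setT (fun x : R => (x ^+ k)%:E).
  exists (fine (\int[normal_prob (0:R) 1]_x (x ^+ k)%:E)%E).
  by split => //; rewrite fineK //; exact: integrable_fin_num i.
apply/integrableP; split => //.
have mexp (c : R) : measurable_fun setT (fun x : R => (expR (c * x))%:E).
  by apply/measurable_EFinP; apply: measurableT_comp => //; exact: measurable_funM.
apply: (@le_lt_trans _ _ (\int[normal_prob (0:R) 1]_x
  (k`!%:R%:E * ((expR (1 * x))%:E + (expR (-1 * x))%:E)))%E).
  apply: ge0_le_integral => //.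
  - by apply: measurableT_comp.
  - by apply: measurable_funeM; apply: emeasurable_funD; exact: mexp.
  move=> x _; rewrite /= -EFinD -EFinM lee_fin mul1r mulN1r.
  have bnd (y : R) : 0 <= y -> y ^+ k <= k`!%:R * expR y.
    move=> y0; case: (k) => [|j].
      by rewrite expr0 fact0 mul1r -[leLHS]expR0 ler_expR.
    rewrite -ler_pdivrMl ?ltr0n ?fact_gt0 // mulrC.
    by apply: le_trans (expR_ge1Dxn j y0); rewrite lerDr.
  have f0 : (0:R) <= k`!%:R by rewrite ler0n.
  rewrite normrX; apply: le_trans (bnd _ (normr_ge0 x)) _; apply: ler_wpM2l => //.
  case: (ger0P x) => x0; first by rewrite lerDl expR_ge0.
  by rewrite lerDr expR_ge0.
rewrite ge0_integralZl //; last 2 first.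
- apply: emeasurable_funD; exact: mexp.
- by move=> x _; rewrite -EFinD lee_fin addr_ge0 ?expR_ge0.
rewrite ge0_integralD //; last 2 first.
- exact: mexp.
- exact: mexp.
by rewrite !integral_expR_normal -EFinD -EFinM ltry.
Qed.

Definition gauss_moment (k : nat) : R := projT1 (cid (exists_gauss_moment k)).

Lemma gauss_momentP (k : nat) :
  (normal_prob (0:R) 1).-integrable setT (fun x : R => (x ^+ k)%:E) /\
  (\int[normal_prob (0:R) 1]_x (x ^+ k)%:E = (gauss_moment k)%:E)%E.
Proof. by rewrite /gauss_moment; case: cid. Qed.

Local Notation N01 := (normal_prob (0:R) 1).

Lemma hasE_gauss_moment k : hasE N01 (fun x : R => x ^+ k) (gauss_moment k).
Proof. exact: gauss_momentP. Qed.

Lemma gauss_moment0 : gauss_moment 0 = 1.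
Proof.
apply: (hasE_unique (hasE_gauss_moment 0)).
by apply: eq_hasE (hasE_cst N01 1) => x; rewrite expr0.
Qed.

(* Integrating 1 + l x <= e^(l x) gives 1 + l m <= e^(l^2/2) for every l, with
   equality at l = 0, so the slope m of the left-hand side must vanish. *)
Lemma gauss_moment1 : gauss_moment 1 = 0.
Proof.
set m := gauss_moment 1.
have key (l : R) : 1 + l * m <= expR (l ^+ 2 / 2).
  apply: (@hasE_le _ _ _ N01 (fun x : R => 1 + l * x ^+ 1) (fun x => expR (l * x))).
  - exact: hasED (hasE_cst _ _) (hasEZ _ (hasE_gauss_moment 1)).
  - apply: hasE_ge0; last exact: integral_expR_normal.
    + by apply: measurableT_comp => //; exact: measurable_funM.
    + by move=> x; exact: expR_ge0.
  - by move=> x; rewrite expr1 expR_ge1Dx.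
apply/eqP; apply: contraT => m0.
have m2 : 0 < m ^+ 2 by rewrite lt0r sqrf_eq0 m0 sqr_ge0.
(* The test point is l = c m. This c gives c m^2 = 1 - c and u = c (1 - c) / 2 < 1 however large m
   is, so that e^u <= 1 / (1 - u) contradicts 1 + c m^2 <= e^u. *)
pose c := (1 + m ^+ 2)^-1.
have c0 : 0 < c by rewrite invr_gt0; lra.
have cm : c * (1 + m ^+ 2) = 1 by rewrite mulVf // gt_eqF //; lra.
have := key (c * m); set u := _ / 2 => hu.
have u0 : u = c ^+ 2 * m ^+ 2 / 2 by rewrite /u exprMn.
have : (1 - u) * expR u <= 1.
  have := expR_ge1Dx (- u); rewrite expRN => h.
  by rewrite -ler_pdivlMr ?expR_gt0 // mul1r.
have eu := expR_gt0 u.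
have u1 : u < 1 by rewrite u0; nra.
have : (1 + c * m * m) * (1 - u) <= expR u * (1 - u) by rewrite ler_wpM2r //; lra.
rewrite -[c * m * m]mulrA -expr2 u0; set q := m ^+ 2 in m2 cm *.
have cq : c * q = 1 - c by move: cm; rewrite mulrDr mulr1; lra.
have -> : c ^+ 2 * q / 2 = c * (c * q) / 2 by rewrite expr2 !mulrA.
rewrite cq => h1; rewrite [X in X <= 1 -> _]mulrC => h2; exfalso.
have c1 : c < 1 by have := mulr_gt0 c0 m2; lra.
have := le_trans h1 h2.
rewrite -subr_ge0 (_ : _ - _ = - ((1 - c) * (1 - c + c ^+ 2 / 2))); last by field.
have c2 := sqr_ge0 c.
have p : 0 < (1 - c) * (1 - c + c ^+ 2 / 2) by apply: mulr_gt0; lra.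
lra.
Qed.

(* The same tangency argument, from 1 + u x^2 <= e^(u x^2) with u = (1 - s^-2) / 2,
   whose right-hand side has mean s: both sides agree at s = 1. *)
Lemma gauss_moment2 : gauss_moment 2 = 1.
Proof.
set m := gauss_moment 2.
have key (s : R) : 0 < s -> 1 + (1 - s^-2) / 2 * m <= s.
  move=> s0.
  apply: (@hasE_le _ _ _ N01 (fun x : R => 1 + (1 - s^-2) / 2 * x ^+ 2)
     (fun x => expR ((1 - s^-2) / 2 * x ^+ 2))).
  - exact: hasED (hasE_cst _ _) (hasEZ _ (hasE_gauss_moment 2)).
  - apply: hasE_ge0; last exact: integral_expR_sqr_normal.
    + by apply: measurableT_comp => //; apply: measurable_funM => //; exact: measurable_funX.
    + by move=> x; exact: expR_ge0.
  - by move=> x; rewrite expR_ge1Dx.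
have key2 (s : R) : 0 < s -> (s ^+ 2 - 1) * m <= 2 * s ^+ 2 * (s - 1).
  move=> s0; have := key s s0; rewrite -(ler_pM2l (exprn_gt0 2 s0)).
  have -> : s ^+ 2 * (1 + (1 - s^-2) / 2 * m) = s ^+ 2 + (s ^+ 2 - 1) / 2 * m.
    by field; rewrite gt_eqF.
  by nra.
have m0 : 0 <= m.
  by apply: (hasE_le (hasE_cst N01 0) (hasE_gauss_moment 2)) => x; exact: sqr_ge0.
apply/eqP; rewrite eq_le; apply/andP; split; rewrite leNgt; apply/negP => m1.
(* Test at s = 1 + h: cancelling h leaves (2 + h)(1 + d) <= 2 (1 + h)^2, which fails since h < d / 3
   and h < 1. The other case tests at s = 1 - h with h = d / 3, where m >= 0 keeps h <= 1/3. *)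
- pose d := m - 1; pose h := d / (3 + d).
  have d0 : 0 < d by rewrite /d; lra.
  have h0 : 0 < h by rewrite divr_gt0 //; lra.
  have hd : h * (3 + d) = d by rewrite divfK // gt_eqF //; lra.
  have h1 : h < 1 by nra.
  have := key2 (1 + h) ltac:(lra); rewrite (_ : m = 1 + d); last by rewrite /d; lra.
  have -> : ((1 + h) ^+ 2 - 1) * (1 + d) = h * ((2 + h) * (1 + d)) by ring.
  have -> : 2 * (1 + h) ^+ 2 * (1 + h - 1) = h * (2 * (1 + h) ^+ 2) by ring.
  by rewrite ler_pM2l //; nra.
- pose d := 1 - m; pose h := d / 3.
  have d0 : 0 < d by rewrite /d; lra.
  have d1 : d <= 1 by rewrite /d; lra.
  have hd : d = 3 * h by rewrite /h; lra.
  have := key2 (1 - h) ltac:(lra); rewrite (_ : m = 1 - 3 * h); last by rewrite -hd /d; lra.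
  have -> : ((1 - h) ^+ 2 - 1) * (1 - 3 * h) = h * (- (2 - h) * (1 - 3 * h)) by ring.
  have -> : 2 * (1 - h) ^+ 2 * (1 - h - 1) = h * (- 2 * (1 - h) ^+ 2) by ring.
  by rewrite ler_pM2l; nra.
Qed.
End gaussian_moments.

Lemma hasE_std_gaussian d (T : measurableType d) (R : realType)
    (P : probability T R) (X : {RV P >-> R}) :
  std_gaussian P X -> forall k, hasE P (fun s => X s ^+ k) (gauss_moment R k).
Proof.
move=> gX k.
have [i h] := gauss_momentP R k.
have mk : measurable_fun setT (fun x : R => (x ^+ k)%:E).
  by apply/measurable_EFinP; exact: measurable_funX.
have mX : @measurable_fun _ _ T (measurableTypeR R) setT X := measurable_funPT X.
pose X' : {mfun T >-> measurableTypeR R} :=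
  HB.pack (X : T -> measurableTypeR R) (isMeasurableFun.Build _ _ _ _ _ mX).
have eI (f : R -> \bar R) :
    (\int[distribution P X']_x f x = \int[normal_prob (0:R) 1]_x f x)%E.
  by apply: (eq_measure_integral (normal_prob (0:R) 1)) => B mB _; exact: gX.
have iX : P.-integrable setT (EFin \o (fun s => X s ^+ k)).
  apply/integrableP; split; first by apply/measurable_EFinP; exact: measurable_funX.
  move/integrableP : i => [_]; rewrite -eI (ge0_integral_distribution X') //.
  exact: measurableT_comp.
split => //.
by rewrite -h -eI (integral_distribution (X := X') mk iX).
Qed.

(** * The matrix I + E^T E *)

Section gram.
Context (R : realType).

(** The matrix determinant lemma: the bordered matrix [M] is eliminated once from each of its
    diagonal blocks. *)
Lemma det_add_rank1 n (B : 'M[R]_n) (r : 'rV[R]_n) : B \in unitmx ->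
  \det (B + r^T *m r) = \det B * (1 + (r *m invmx B *m r^T) 0 0).
Proof.
move=> uB; pose M := block_mx (1%:M : 'M[R]_1) (- r) r^T B.
have d1 : \det (M *m block_mx 1%:M r 0 1%:M) = \det M.
  by rewrite det_mulmx det_ublock !det1 !mulr1.
have d2 : \det (M *m block_mx 1%:M 0 (- (invmx B *m r^T)) 1%:M) = \det M.
  by rewrite det_mulmx det_lblock !det1 !mulr1.
move: d1 d2; rewrite !mulmx_block !mulmx0 !mulmx1 !mul1mx !addr0 !add0r.
rewrite subrr det_lblock det1 mul1r => d1.
rewrite [B *m - _]mulmxN mulKVmx // subrr det_ublock => d2.
rewrite addrC d1 -d2 det_mx11 mulrC; congr (_ * _).
by rewrite mulNmx mulmxN opprK mulmxA !mxE.
Qed.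

Definition gram1 m n (E : 'M[R]_(m, n)) : 'M[R]_n := 1%:M + E^T *m E.

Lemma tr_gram1 m n (E : 'M[R]_(m, n)) : (gram1 E)^T = gram1 E.
Proof. by rewrite /gram1 linearD /= trmx1 trmx_mul trmxK. Qed.

Lemma gram1_quad m n (E : 'M[R]_(m, n)) (w : 'rV[R]_n) :
  (w *m gram1 E *m w^T) 0 0 =
  \sum_j w 0 j ^+ 2 + \sum_i (E *m w^T) i 0 ^+ 2.
Proof.
rewrite /gram1 mulmxDr mulmx1 mulmxDl mxE; congr (_ + _).
  by rewrite mxE; apply: eq_bigr => j _; rewrite mxE expr2.
rewrite !mulmxA -(mulmxA _ E) mxE; apply: eq_bigr => i _.
by rewrite -[in X in X * _](trmxK w) -trmx_mul mxE expr2.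
Qed.

Lemma gram1_col_mx m n (r : 'rV[R]_n) (E : 'M[R]_(m, n)) :
  gram1 (col_mx r E) = gram1 E + r^T *m r.
Proof. by rewrite /gram1 tr_col_mx mul_row_col addrAC addrA. Qed.

(** Writing r = w G with G = [gram1 E], the form becomes w G w^T, a sum of squares. *)
Lemma quad_invmx_ge0 m n (E : 'M[R]_(m, n)) (r : 'rV[R]_n) :
  gram1 E \in unitmx -> 0 <= (r *m invmx (gram1 E) *m r^T) 0 0.
Proof.
move=> u; set w := r *m invmx (gram1 E).
have -> : r = w *m gram1 E by rewrite mulmxKV.
rewrite trmx_mul tr_gram1 mulmxA gram1_quad addr_ge0 // sumr_ge0 // => *; exact: sqr_ge0.
Qed.

Lemma det_gram1_ge1 m n (E : 'M[R]_(m, n)) : 1 <= \det (gram1 E).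
Proof.
elim: m E => [|m IH] E.
  by rewrite /gram1 (flatmx0 E) mulmx0 addr0 det1.
have := IH (dsubmx (E : 'M[R]_(1 + m, n))); set E' := dsubmx _ => h.
have u : gram1 E' \in unitmx by rewrite unitmxE unitfE gt_eqF // (lt_le_trans ltr01 h).
rewrite -(vsubmxK (E : 'M[R]_(1 + m, n))) gram1_col_mx det_add_rank1 //.
by apply: mulr_ege1 => //; rewrite lerDl quad_invmx_ge0.
Qed.

Lemma gram1_unit m n (E : 'M[R]_(m, n)) : gram1 E \in unitmx.
Proof. by rewrite unitmxE unitfE gt_eqF // (lt_le_trans ltr01 (det_gram1_ge1 _)). Qed.

Section inverse.
Variables (m n : nat) (E : 'M[R]_(m, n)).
Let H := invmx (gram1 E).

Lemma tr_invgram : H^T = H.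
Proof. by rewrite /H trmx_inv tr_gram1. Qed.

(** Compare the diagonals in H = H (I + E^T E) H. *)
Lemma invgram_diag j : H j j = \sum_k H j k ^+ 2 + \sum_i (E *m H) i j ^+ 2.
Proof.
have h := gram1_quad E (row j H).
transitivity ((H *m gram1 E *m H) j j); first by rewrite mulVmx ?gram1_unit // mul1mx.
transitivity ((row j H *m gram1 E *m (row j H)^T) 0 0).
  rewrite -row_mul tr_row tr_invgram [LHS]mxE [RHS]mxE.
  by apply: eq_bigr => k _; congr (_ * _); rewrite [RHS]mxE.
rewrite h; congr (_ + _); first by apply: eq_bigr => k _; rewrite mxE.
apply: eq_bigr => i _; congr (_ ^+ 2); rewrite [LHS]mxE [RHS]mxE.
by apply: eq_bigr => k _; rewrite tr_row tr_invgram [in LHS]mxE.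
Qed.

Lemma invgram_row_sqr j : \sum_k H j k ^+ 2 <= H j j.
Proof. by rewrite [leRHS]invgram_diag lerDl sumr_ge0 // => *; exact: sqr_ge0. Qed.

Lemma invgram_diag_ge0 j : 0 <= H j j.
Proof. by apply: le_trans (invgram_row_sqr j); rewrite sumr_ge0 // => *; exact: sqr_ge0. Qed.

Lemma invgram_diag_le1 j : H j j <= 1.
Proof.
have h := invgram_row_sqr j.
have : H j j ^+ 2 <= H j j.
  by apply: le_trans h; rewrite (bigD1 j) //= lerDl sumr_ge0 // => *; exact: sqr_ge0.
have := invgram_diag_ge0 j; nra.
Qed.

(** With v the i-th row of E and w = v H, the leverage is k = w G w^T = |w|^2 + |E w^T|^2, where G =
    [gram1 E]. The i-th entry of E w^T is k itself, so k^2 <= k. *)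
Lemma invgram_leverage i : (E *m H *m E^T) i i <= (row i E != 0)%:R.
Proof.
set v := row i E; set w := v *m H.
have e : (E *m H *m E^T) i i = (w *m v^T) 0 0.
  by rewrite /w -row_mul mxE [RHS]mxE; apply: eq_bigr => k _; rewrite !mxE.
have [v0|_] /= := eqVneq v 0; first by rewrite e /w v0 !mul0mx mxE.
set k := (E *m H *m E^T) i i in e *.
have : k ^+ 2 <= k.
  have -> : k = (w *m gram1 E *m w^T) 0 0.
    by rewrite e /w mulmxKV ?gram1_unit // trmx_mul tr_invgram mulmxA.
  rewrite [leRHS]gram1_quad.
  rewrite -[leLHS]add0r; apply: lerD; first by rewrite sumr_ge0 // => *; exact: sqr_ge0.
  rewrite (bigD1 i) //= -[leLHS]addr0; apply: lerD.
    rewrite (_ : (w *m gram1 E *m w^T) 0 0 = (E *m w^T) i 0) //.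
    rewrite /w mulmxKV ?gram1_unit // !mxE; apply: eq_bigr => j _.
    by rewrite !mxE.
  by rewrite sumr_ge0 // => *; exact: sqr_ge0.
have := sqr_ge0 k; nra.
Qed.

Lemma trace_invgram_ge : n%:R - \sum_i (row i E != 0)%:R <= \tr H.
Proof.
have h : H + E^T *m (E *m H) = 1%:M.
  by rewrite mulmxA -[X in X + _]mul1mx -mulmxDl mulmxV ?gram1_unit.
have := congr1 (@mxtrace _ n) h; rewrite mxtraceD mxtrace1 mxtrace_mulC => <-.
rewrite lerBlDr lerD2l; apply: ler_sum => i _; exact: invgram_leverage.
Qed.

End inverse.
End gram.

(** * Quadratic forms in independent Gaussian variables *)

Lemma indep_reindex d (T : measurableType d) (R : realType) (P : probability T R)
    (I J : finType) (S : {set I}) (X : I -> {RV P >-> R}) (f : J -> I) :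
  mutually_independent P S (fun i => X i : T -> R) ->
  injective f -> (forall j, f j \in S) -> independent_family (fun j => X (f j)).
Proof.
move=> indX injf fS B mB.
(* Indices outside the image of [f] get the whole line and contribute a factor 1. *)
pose B' i := if [pick j | f j == i] is Some j then B j else setT.
have B'f j : B' (f j) = B j.
  rewrite /B'; case: pickP => [k /eqP /injf -> //|/(_ j)]; by rewrite eqxx.
have B'n i : i \notin codom f -> B' i = setT.
  rewrite /B'; case: pickP => [k /eqP <-|//]; by rewrite codom_f.
have mB' i : measurable (B' i) by rewrite /B'; case: pickP.
have := indX B' mB'.
rewrite (_ : \bigcap_(p in _) _ = [set s | forall j, B j (X (f j) s)]); last first.
  apply/seteqP; split => s /= h.
    by move=> j; have := h (f j) (fS j); rewrite /preimage /= B'f.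
  move=> i iS; have [/codomP[j ->]|ni] := boolP (i \in codom f).
    by rewrite /preimage /= B'f.
  by rewrite B'n.
move=> ->.
have -> : (\prod_(p in S) P (X p @^-1` B' p) =
    \prod_(p in [set f j | j : J]%SET) P (X p @^-1` B' p))%E.
  rewrite (bigID (fun i => i \in codom f)) /= [X in (_ * X)%E]big1 ?mule1; last first.
    by move=> i /andP[_ ni]; rewrite B'n // preimage_setT probability_setT.
  apply: eq_bigl => i; apply/andP/imsetP => [[_ /codomP[j ->]]|[j _ ->]].
    by exists j.
  by rewrite fS codom_f.
rewrite big_imset /=; last by move=> *; exact: injf.
by apply: eq_bigr => j _; rewrite B'f.
Qed.

Lemma indep_mutual d (T : measurableType d) (R : realType) (P : probability T R)
    (I : finType) (X : I -> {RV P >-> R}) :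
  independent_family X -> mutually_independent P [set: I]%SET (fun i => X i : T -> R).
Proof.
move=> indX B mB; rewrite (_ : \bigcap_(p in _) _ = [set s | forall p, B p (X p s)]).
  by rewrite indX //; apply: eq_bigl => p; rewrite inE.
apply/seteqP; split => s /= h p; first by apply: h; rewrite /= inE.
by move=> _; apply: h.
Qed.

Lemma hasE_ln d (T : measurableType d) (R : realType) (P : probability T R)
    (f : T -> R) (v : R) : hasE P f v -> (forall s, 1 <= f s) ->
  exists L, hasE P (fun s => ln (f s)) L.
Proof.
move=> [i h] f1.
have mf : measurable_fun setT f by apply/measurable_EFinP; exact: measurable_int i.
have il : P.-integrable setT (EFin \o (fun s => ln (f s))).
  apply: le_integrable i => //.
    by apply/measurable_EFinP; exact: (measurableT_comp (@measurable_ln R)).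
  move=> s _ /=; rewrite lee_fin ger0_norm ?ln_ge0 //.
  rewrite ger0_norm ?(le_trans ler01) //; apply: ltW; apply: ln_sublinear.
  exact: lt_le_trans ltr01 (f1 s).
exists (fine (\int[P]_s (ln (f s))%:E)%E); split => //.
by rewrite fineK //; exact: integrable_fin_num il.
Qed.

Section quadratic_form.
Context d (T : measurableType d) (R : realType) (P : probability T R).
Variables (I : finType) (X : I -> {RV P >-> R}).
Hypothesis indX : independent_family X.
Hypothesis gX : forall p, std_gaussian P (X p).
Local Notation mom := (@gauss_moment R).

(* Isserlis' formula.  For the normal law the last coefficient is 0, but only the
   finiteness of the fourth moment is needed. *)
Definition wick (j k l p : I) : R :=
  ((j == k) && (l == p))%:R + ((j == l) && (k == p))%:R + ((j == p) && (k == l))%:R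
  + (mom 4 - 3) * [&& j == k, k == l & l == p]%:R.

Let prod_pow (F : I -> R) (j : I) : \prod_q F q ^+ (q == j) = F j.
Proof.
rewrite (bigD1 j) //= eqxx expr1 big1 ?mulr1 // => q /negbTE ->.
by rewrite expr0.
Qed.

Lemma hasE_two j k : hasE P (fun s => X j s * X k s) (j == k)%:R.
Proof.
have h := hasE_monomial indX (fun q => (q == j) + (q == k))%N
  (fun p => hasE_std_gaussian (gX p)).
have e : \prod_q mom ((q == j) + (q == k)) = (j == k)%:R.
  rewrite (bigD1 j) //= eqxx; case: eqVneq => [<-|jk].
    rewrite gauss_moment2 mul1r big1 // => q /negbTE ->; exact: gauss_moment0.
  by rewrite gauss_moment1 mul0r.
rewrite e in h; apply: eq_hasE h => s.
under eq_bigr do rewrite exprD.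
by rewrite big_split /= !prod_pow.
Qed.

(** Unless the four indices pair up, some index occurs exactly once, and the vanishing first moment
    kills the product; when exactly three agree, this index is the fourth. *)
Lemma hasE_four j k l p :
  hasE P (fun s => X j s * X k s * X l s * X p s) (wick j k l p).
Proof.
pose e q := ((q == j) + (q == k) + (q == l) + (q == p))%N.
have h := hasE_monomial indX e (fun p => hasE_std_gaussian (gX p)).
have odd0 q : e q = 1%N -> \prod_q mom (e q) = 0.
  by move=> eq1; rewrite (bigD1 q) //= eq1 gauss_moment1 mul0r.
have E : \prod_q mom (e q) = wick j k l p.
  rewrite /wick.
  have pair (a b : I) : a != b -> (forall q, e q = ((q == a).*2 + (q == b).*2)%N) ->
      \prod_q mom (e q) = 1.
    move=> ab he; apply: big1 => q _; rewrite he.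
    case: (eqVneq q a) => [->|]; first by rewrite (negbTE ab) gauss_moment2.
    by case: (q == b) => _; rewrite ?gauss_moment2 ?gauss_moment0.
  case: (eqVneq j k) => [jk|jk]; last case: (eqVneq j l) => [jl|jl];
    last case: (eqVneq j p) => [jp|jp].
  - subst k; case: (eqVneq l p) => [lp|lp].
      subst p; case: (eqVneq j l) => [jl|jl].
        subst l; rewrite (bigD1 j) //= /e eqxx big1; first by rewrite /=; lra.
        by move=> q /negbTE ->; exact: gauss_moment0.
      rewrite (pair j l) //=; first by lra.
      by move=> q; rewrite /e -!addnn addnA.
    case: (eqVneq j l) => [jl|jl].
      subst l; rewrite (odd0 p) ?(negbTE lp) /=; first by lra.
      by rewrite /e eqxx eq_sym (negbTE lp).
    rewrite (odd0 l) /= ?andbF /=; first by lra.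
    by rewrite /e eqxx (negbTE lp) eq_sym (negbTE jl).
  - subst l; rewrite [k == j]eq_sym (negbTE jk) /= ?andbF /=.
    case: (eqVneq k p) => [kp|kp].
      subst p; rewrite (pair j k) //=; first by lra.
      by move=> q; rewrite /e -!addnn; lia.
    rewrite (odd0 k) /=; first by lra.
    by rewrite /e eqxx eq_sym (negbTE jk) (negbTE kp).
  - subst p; rewrite [l == j]eq_sym (negbTE jl) /= ?andbF.
    case: (eqVneq k l) => [kl|kl].
      subst l; rewrite (pair j k) //=; first by lra.
      by move=> q; rewrite /e -!addnn; lia.
    rewrite (odd0 k) /=; first by lra.
    by rewrite /e eqxx eq_sym (negbTE jk) (negbTE kl).
  - rewrite (odd0 j) /=; first by lra.
    by rewrite /e eqxx (negbTE jk) (negbTE jl) (negbTE jp).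
rewrite E in h; apply: eq_hasE h => s; rewrite /e.
under eq_bigr do rewrite !exprD.
by rewrite !big_split /= !prod_pow.
Qed.

Variable M : I -> I -> R.
Hypothesis symM : forall j k, M j k = M k j.

Definition quad (s : T) : R := \sum_j \sum_k M j k * (X j s * X k s).

Lemma sum_delta (F : I -> R) j : \sum_k F k * (j == k)%:R = F j.
Proof.
rewrite (bigD1 j) //= eqxx mulr1 big1 ?addr0 // => k.
by rewrite eq_sym => /negbTE ->; rewrite mulr0.
Qed.

Lemma hasE_quad : hasE P quad (\sum_j M j j).
Proof.
have h : hasE P quad (\sum_j \sum_k M j k * (j == k)%:R).
  by apply: hasE_sum => j _; apply: hasE_sum => k _; apply: hasEZ; exact: hasE_two.
by congr (hasE P quad _): h; apply: eq_bigr => j _; exact: sum_delta.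
Qed.

Lemma hasE_quad_sqr : hasE P (fun s => quad s ^+ 2)
  ((\sum_j M j j) ^+ 2 + 2 * (\sum_j \sum_k M j k ^+ 2)
    + (mom 4 - 3) * \sum_j M j j ^+ 2).
Proof.
have h : hasE P (fun s => \sum_j \sum_k \sum_l \sum_p M j k * M l p *
      (X j s * X k s * X l s * X p s))
    (\sum_j \sum_k \sum_l \sum_p M j k * M l p * wick j k l p).
  do 4! (apply: hasE_sum => ? _); apply: hasEZ; exact: hasE_four.
have e1 : (fun s => \sum_j \sum_k \sum_l \sum_p M j k * M l p *
      (X j s * X k s * X l s * X p s)) =1 (fun s => quad s ^+ 2).
  move=> s; rewrite expr2 {1}/quad big_distrl /=; apply: eq_bigr => j _.
  rewrite big_distrl /=; apply: eq_bigr => k _.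
  rewrite /quad big_distrr /=; apply: eq_bigr => l _.
  by rewrite big_distrr /=; apply: eq_bigr => p _; ring.
apply: eq_hasE e1 _; congr (hasE P _ _): h.
(* The deltas are ordered for [sum_delta] to collapse the inner sums. The pairing within each factor
   gives the squared trace, and each crossed pairing gives the squared Frobenius norm, the second
   one by symmetry of [M]. *)
have e2 j k l p : M j k * M l p * wick j k l p =
    (M j k * (j == k)%:R) * (M l p * (l == p)%:R)
    + M j k * (M l p * (k == p)%:R * (j == l)%:R)
    + M j k * (M l p * (j == p)%:R * (k == l)%:R)
    + (mom 4 - 3) * (M j k * (M l p * (l == p)%:R) * (k == l)%:R * (j == k)%:R).
  rewrite /wick -!mulnb !natrM; ring.
under eq_bigr => j _ do under eq_bigr => k _ do under eq_bigr => l _ do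
  under eq_bigr => p _ do rewrite e2.
under eq_bigr => j _ do under eq_bigr => k _ do under eq_bigr => l _ do
  rewrite !big_split /=.
under eq_bigr => j _ do under eq_bigr => k _ do rewrite !big_split /=.
under eq_bigr => j _ do rewrite !big_split /=.
rewrite !big_split /= -!addrA; congr (_ + _).
  rewrite expr2 [RHS]big_distrl /=; apply: eq_bigr => j _.
  under eq_bigr => k _ do under eq_bigr => l _ do rewrite -big_distrr /= sum_delta.
  under eq_bigr => k _ do rewrite -big_distrr /=.
  by rewrite -big_distrl /= sum_delta.
rewrite mulrDl mul1r -addrA; congr (_ + _).
  apply: eq_bigr => j _; apply: eq_bigr => k _.
  under eq_bigr => l _ do rewrite -big_distrr /= -big_distrl /= sum_delta.
  by rewrite -big_distrr /= sum_delta expr2.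
congr (_ + _).
  apply: eq_bigr => j _; apply: eq_bigr => k _.
  under eq_bigr => l _ do rewrite -big_distrr /= -big_distrl /= sum_delta.
  by rewrite -big_distrr /= sum_delta expr2 [M k j]symM.
rewrite big_distrr /=; apply: eq_bigr => j _.
under eq_bigr => k _ do under eq_bigr => l _ do
  rewrite -big_distrr /= -big_distrl /= -big_distrl /= -big_distrr /= sum_delta.
under eq_bigr => k _ do rewrite -big_distrr /= -big_distrl /= sum_delta.
by rewrite -big_distrr /= sum_delta expr2.
Qed.


(** For z >= 1/2 use ln z >= 1 - 1/z = (z - 1) - (z - 1)^2 / z. Below 1/2 one has 4 (z - 1)^2 >= 1,
    so the term 4 l (z - 1)^2 absorbs the a priori bound - l. *)
Lemma ln_ge_quadratic (z l : R) : 0 < z -> 0 <= l -> - l <= ln z ->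
  (z - 1) - (2 + 4 * l) * (z - 1) ^+ 2 <= ln z.
Proof.
move=> z0 l0 lz; have sq := sqr_ge0 (z - 1).
have [z2|z2] := lerP (1 / 2) z; last first.
  have : (1 / 2) ^+ 2 <= (z - 1) ^+ 2.
    by rewrite -[leRHS]sqrrN; apply: lerXn2r; rewrite ?nnegrE; lra.
  by nra.
have zi : 0 < z^-1 by rewrite invr_gt0.
have : ln (z^-1) <= z^-1 - 1.
  by have := @le_ln1Dx _ (z^-1 - 1); rewrite addrCA subrr addr0; apply; lra.
rewrite lnV ?posrE // lerNl opprB; apply: le_trans.
have -> : 1 - z^-1 = (z - 1) - (z - 1) ^+ 2 / z by field; rewrite gt_eqF.
rewrite lerD2l lerN2 mulrC ler_wpM2r //.
have : z^-1 <= 2 by rewrite -[2]invrK lef_pV2 ?posrE //; lra.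
by lra.
Qed.

(** The variance of [quad] is at most this constant times the squared Frobenius norm of [M]. *)
Definition wick_const : R := 2 + `|mom 4 - 3|.

Lemma wick_const_ge0 : 0 <= wick_const.
Proof. by rewrite /wick_const; have := normr_ge0 (mom 4 - 3); lra. Qed.

Hypothesis quad_ge0 : forall s, 0 <= quad s.
Let mu := 1 + \sum_j M j j.

Lemma hasE_1quad : hasE P (fun s => 1 + quad s) mu.
Proof. exact: hasED (hasE_cst _ _) hasE_quad. Qed.

Lemma quad_mean_ge1 : 1 <= mu.
Proof. by apply: (hasE_le (hasE_cst P 1) hasE_1quad) => s; rewrite lerDl. Qed.

(** Take the mean of [ln_ge_quadratic] at z = (1 + quad) / mu with l = ln mu, admissible since 1 +
    quad >= 1. The linear term has mean 0 and the quadratic term gives the relative variance. *)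
Lemma ln_quad_gap : exists L, hasE P (fun s => ln (1 + quad s)) L /\
  ln mu <= (2 + 4 * ln mu) * (wick_const * (\sum_j \sum_k M j k ^+ 2) / mu ^+ 2) + L.
Proof.
have mu1 := quad_mean_ge1; have mu0 : 0 < mu by rewrite (lt_le_trans ltr01).
have q1 s : 1 <= 1 + quad s by rewrite lerDl.
have [L hL] := hasE_ln hasE_1quad q1; exists L; split => //.
set V := \sum_j \sum_k _.
pose nu := \sum_j M j j.
have dev : hasE P (fun s => quad s ^+ 2 + (- 2 * nu) * quad s + nu ^+ 2)
   (2 * V + (mom 4 - 3) * \sum_j M j j ^+ 2).
  have h := hasED (hasED hasE_quad_sqr (hasEZ (- 2 * nu) hasE_quad)) (hasE_cst P (nu ^+ 2)).
  congr (hasE P _ _): h; rewrite -/nu -/V; ring.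
have V0 : \sum_j M j j ^+ 2 <= V.
  apply: ler_sum => j _; rewrite [leRHS](bigD1 j) //= lerDl.
  by apply: sumr_ge0 => k _; exact: sqr_ge0.
have V00 : 0 <= \sum_j M j j ^+ 2 by apply: sumr_ge0 => j _; exact: sqr_ge0.
pose K := 2 + 4 * ln mu; have l0 : 0 <= ln mu by exact: ln_ge0.
have low := hasED (hasEZ mu^-1 (hasED hasE_quad (hasE_cst P (- nu))))
   (hasEZ (- K * mu ^- 2) dev).
have up := hasED hL (hasE_cst P (- ln mu)).
have := hasE_le low up; rewrite addrN mulr0 add0r => h.
have {h} : - K * mu ^- 2 * (2 * V + (mom 4 - 3) * \sum_j M j j ^+ 2) <= L - ln mu.
  apply: h => s; pose z := (1 + quad s) / mu.
  have z0 : 0 < z by rewrite divr_gt0 // (lt_le_trans ltr01).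
  have ez : ln z = ln (1 + quad s) - ln mu by rewrite ln_div ?posrE // (lt_le_trans ltr01).
  rewrite -ez; apply: le_trans (@ln_ge_quadratic z (ln mu) z0 l0 _); last first.
    by rewrite ez; have := ln_ge0 (q1 s); lra.
  have -> : z - 1 = (quad s - nu) / mu.
    rewrite /z /mu -/nu; field; rewrite gt_eqF //.
  rewrite -/K le_eqVlt; apply/orP; left; apply/eqP.
  by field; rewrite gt_eqF.
have : (2 * V + (mom 4 - 3) * \sum_j M j j ^+ 2) <= wick_const * V.
  rewrite /wick_const [leRHS]mulrDl lerD2l; apply: le_trans (ler_wpM2l (normr_ge0 _) V0).
  by rewrite ler_wpM2r // ler_norm.
have K0 : 0 <= K * mu ^- 2 by rewrite mulr_ge0 ?invr_ge0 ?exprn_ge0 ?ltW // /K; lra.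
move=> /(ler_wpM2l K0); rewrite -/K.
by rewrite mulNr mulNr (mulrCA K) (mulrC (wick_const * V)) -mulrA; rewrite mulrA; lra.
Qed.

End quadratic_form.

(** * The logarithmic gap over independent blocks *)

Definition log_gap d (T : measurableType d) (R : realType) (P : probability T R)
    (c : R) (f : T -> R) :=
  exists v L, [/\ hasE P f v, hasE P (fun s => ln (f s)) L & ln v <= c + L].

Section two_blocks.
Context d1 d2 (T1 : measurableType d1) (T2 : measurableType d2) (R : realType).
Variables (P : probability T1 R) (Q : probability T2 R).
Variables (c1 c2 : R) (g : T1 * T2 -> R) (v : R).
Hypothesis g1 : forall z, 1 <= g z.
Hypothesis gap1 : forall y, log_gap P c1 (fun x => g (x, y)).
Hypothesis gap2 : forall x, log_gap Q c2 (fun y => g (x, y)).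
Hypothesis Eg : hasE (P \x Q)%E g v.

Let g0 z : 0 < g z. Proof. exact: lt_le_trans ltr01 (g1 z). Qed.

Let mg : measurable_fun setT g.
Proof. by apply/measurable_EFinP; exact: measurable_int (Eg.1). Qed.

(* With l x the mean of ln g(x, _) and L the total mean of ln g, Jensen's inequality
   gives exp(h y - L) <= mean_x (g(x, y) exp(- l x)) for the mean h y of ln g(_, y);
   integrating over y bounds mean exp(h) by exp(c2 + L). *)
Lemma log_gap_prod : log_gap (P \x Q)%E (c1 + c2) g.
Proof.
have [L hL] := hasE_ln Eg g1.
exists v, L; split => //.
have /choice[h hh] : forall y, exists l, hasE P (fun x => ln (g (x, y))) l.
  by move=> y; have [? [l []]] := gap1 y; exists l.
have /choice[l hl] : forall x, exists l, hasE Q (fun y => ln (g (x, y))) l.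
  by move=> x; have [? [l []]] := gap2 x; exists l.
have l0 x : 0 <= l x.
  by apply: (hasE_le (hasE_cst Q 0) (hl x)) => y; rewrite ln_ge0.
have eh y : (\int[P]_x (ln (g (x, y)))%:E = (h y)%:E)%E by have [] := hh y.
have el x : (\int[Q]_y (ln (g (x, y)))%:E = (l x)%:E)%E by have [] := hl x.
have iL := hL.1.
have ml : measurable_fun setT l.
  apply/measurable_EFinP.
  rewrite (_ : EFin \o l = (fun x => \int[Q]_y (ln (g (x, y)))%:E)%E).
    exact: (measurable_fubini_F iL).
  by apply/funext => x; rewrite el.
have mh : measurable_fun setT h.
  apply/measurable_EFinP.
  rewrite (_ : EFin \o h = (fun y => \int[P]_x (ln (g (x, y)))%:E)%E).
    exact: (measurable_fubini_G iL).
  by apply/funext => y; rewrite eh.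
have El : hasE P l L.
  apply: hasE_ge0 => //; rewrite -hL.2 -(integral12_prod_meas1 iL).
  by apply: eq_integral => x _; rewrite /fubini_F el.
have gl y x : expR (ln (g (x, y)) - l x) = g (x, y) * expR (- l x).
  by rewrite expRD lnK ?posrE.
have mgl : measurable_fun setT (fun z => (g z * expR (- l z.1))%:E).
  apply/measurable_EFinP; apply: measurable_funM => //.
  apply: measurableT_comp => //; apply: measurableT_comp => //.
  exact: (measurableT_comp ml measurable_fst).
have gl0 (z : T1 * T2) : (0 <= (g z * expR (- l z.1))%:E)%E.
  by rewrite lee_fin mulr_ge0 ?expR_ge0 // ltW.
have jensen y : ((expR (h y - L))%:E <= \int[P]_x (g (x, y) * expR (- l x))%:E)%E.
  have lin := hasED (hh y) (hasEZ (-1) El).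
  (* [z0] is the mean over x of ln g(x, y) - l x; Jensen's inequality comes from the tangent of exp
     at [z0]. *)
  pose z0 := h y + (- 1) * L.
  have aff := hasEZ (expR z0) (hasED lin (hasE_cst P (1 - z0))).
  have -> : h y - L = z0 by rewrite /z0 mulN1r.
  have -> : expR z0 = expR z0 * (h y + -1 * L + (1 - z0)) by rewrite /z0; ring.
  rewrite -aff.2; apply: le_integral => //; first exact: aff.1.
    apply/integrableP; split.
      exact: (measurableT_comp mgl (measurable_pair2 y)).
    have [w [_ [[iw hw] _ _]]] := gap1 y.
    apply: le_lt_trans (integrable_lty measurableT (integrable_norm iw)).
    apply: ge0_le_integral => //.
    - apply: measurableT_comp => //; exact: (measurableT_comp mgl (measurable_pair2 y)).
    - exact: (measurable_int P (integrable_norm iw)).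
    move=> x _; rewrite /= lee_fin normrM ler_piMr //.
    by rewrite ger0_norm ?expR_ge0 // expR_le1 oppr_le0.
  move=> x _; rewrite lee_fin -gl mulN1r.
  set z := ln _ - l x; have -> : z = z0 + (z - z0) by lra.
  rewrite expRD ler_wpM2l ?expR_ge0 //.
  by have := expR_ge1Dx (z - z0); lra.
(* By [gap2], for fixed x the mean of g(x, y) exp(- l x) over y is at most exp(c2); Tonelli lets y
   be integrated first in [jensen]. *)
have Eh : (\int[Q]_y (expR (h y - L))%:E <= (expR c2)%:E)%E.
  apply: (@le_trans _ _ (\int[Q]_y \int[P]_x (g (x, y) * expR (- l x))%:E)%E).
    apply: ge0_le_integral => //.
    - apply/measurable_EFinP; apply: measurableT_comp => //; exact: measurable_funB.
    - exact: (measurable_fun_fubini_tonelli_G _ mgl gl0).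
  rewrite -(fubini_tonelli _ mgl gl0).
  apply: (@le_trans _ _ (\int[P]_x (expR c2)%:E)%E); last first.
    by rewrite integral_cst //= probability_setT mule1.
  apply: ge0_le_integral => //.
  - by move=> x _; apply: integral_ge0 => y _; exact: gl0.
  - exact: (measurable_fun_fubini_tonelli_F _ mgl gl0).
  move=> x _; have [w [l' [[iw hw] hl' le]]] := gap2 x.
  have e' := hasE_unique hl' (hl x); subst l'.
  under eq_integral => y _ do rewrite mulrC.
  rewrite (hasEZ (expR (- l x)) (conj iw hw)).2 lee_fin mulrC.
  have w0 : 0 < w.
    apply: lt_le_trans ltr01 _.
    by apply: (hasE_le (hasE_cst Q 1) (conj iw hw)).
  rewrite -(@lnK _ w) ?posrE // -expRD ler_expR; lra.
have v0 : 0 < v by apply: lt_le_trans ltr01 _; apply: (hasE_le (hasE_cst _ 1) Eg).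
have mgE : measurable_fun setT (fun z => (g z)%:E) by exact/measurable_EFinP.
have gE0 z : (0 <= (g z)%:E)%E by rewrite lee_fin ltW.
(* By [gap1], the mean of g(x, y) over x is at most exp(c1 + h y). *)
have vle : (v%:E <= (expR (c1 + c2 + L))%:E)%E.
  rewrite -Eg.2 (fubini_tonelli2 _ mgE gE0).
  apply: (@le_trans _ _ (\int[Q]_y ((expR (c1 + L))%:E * (expR (h y - L))%:E))%E).
    apply: ge0_le_integral => //.
    - by move=> y _; apply: integral_ge0.
    - exact: (measurable_fun_fubini_tonelli_G _ mgE gE0).
    - apply: measurable_funeM; apply/measurable_EFinP; apply: measurableT_comp => //.
      exact: measurable_funB.
    move=> y _; have [w [h' [hw hh' le]]] := gap1 y.
    have e' := hasE_unique hh' (hh y); subst h'.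
    rewrite /fubini_G hw.2 -EFinM lee_fin -expRD.
    have w0 : 0 < w.
      by apply: lt_le_trans ltr01 _; apply: (hasE_le (hasE_cst P 1) hw).
    rewrite -[leLHS](@lnK _ w) ?posrE // ler_expR; lra.
  rewrite ge0_integralZl //; last first.
    by apply/measurable_EFinP; apply: measurableT_comp => //; exact: measurable_funB.
  apply: (le_trans (lee_wpmul2l _ Eh)); first by rewrite lee_fin expR_ge0.
  by rewrite -EFinM lee_fin -expRD ler_expR; lra.
by rewrite -ler_expR lnK ?posrE.
Qed.

End two_blocks.

(** * The gap for random Gram determinants *)

Lemma gram1_row (R : realType) m n (E E0 : 'M[R]_(m, n)) (i : 'I_m) :
  (forall l j, l != i -> E l j = E0 l j) -> (forall j, E0 i j = 0) ->
  gram1 E = gram1 E0 + (row i E)^T *m row i E.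
Proof.
move=> h h0; rewrite /gram1 -addrA; congr (_ + _).
apply/matrixP => j k; rewrite !mxE big_ord1 (bigD1 i) //= [in RHS](bigD1 i) //=.
rewrite !mxE h0 mul0r add0r addrC; congr (_ + _).
by apply: eq_bigr => l li; rewrite !mxE !h.
Qed.

Lemma sum_ltn_le (m k : nat) : (\sum_(l < m) (l < k) <= k)%N.
Proof.
have -> : (\sum_(l < m) (l < k) = minn m k)%N; last exact: geq_minr.
elim: m => [|m IH]; first by rewrite big_ord0 min0n.
by rewrite big_ord_recr /= IH; case: (ltnP m k) => ?; lia.
Qed.

Lemma hasE_prod_bound d1 d2 (T1 : measurableType d1) (T2 : measurableType d2)
    (R : realType) (P : probability T1 R) (Q : probability T2 R)
    (g : T1 * T2 -> R) (f : T1 -> R) (w : R) :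
  measurable_fun setT g -> (forall z, 0 <= g z) -> hasE P f w ->
  (forall x, exists v, hasE Q (fun y => g (x, y)) v /\ v <= f x) ->
  exists v, hasE (P \x Q)%E g v /\ v <= w.
Proof.
move=> mg g0 Ef h.
have mgE : measurable_fun setT (fun z => (g z)%:E) by exact/measurable_EFinP.
have gE0 z : (0 <= (g z)%:E)%E by rewrite lee_fin.
have le : (\int[P \x Q]_z (g z)%:E <= w%:E)%E.
  rewrite (fubini_tonelli1 _ mgE gE0) -Ef.2; apply: ge0_le_integral => //.
  - by move=> x _; apply: integral_ge0.
  - exact: (measurable_fun_fubini_tonelli_F _ mgE gE0).
  - exact: (measurable_int P Ef.1).
  - by move=> x _; have [v [[_ hv] vf]] := h x; rewrite /fubini_F hv lee_fin.
have fin : (\int[P \x Q]_z (g z)%:E)%E \is a fin_num.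
  by rewrite ge0_fin_numE ?integral_ge0 // (le_lt_trans le) // ltry.
exists (fine (\int[P \x Q]_z (g z)%:E)%E); split.
  by apply: hasE_ge0 => //; rewrite fineK.
by rewrite -lee_fin fineK.
Qed.

Section transfer.
Context d (T : measurableType d) (R : realType) (P : probability T R).
Variables (I : finType) (X : I -> {RV P >-> R}).
Hypothesis indX : independent_family X.

(* By independence, [splice A] of two independent copies of the sample has the law
   of the sample: this is how one block of variables is integrated separately. *)
Lemma hasE_splice (A : {set I}) (F : cyl R I -> R) v :
  measurable_fun setT F -> (forall x, 0 <= F x) ->
  hasE (P \x P)%E (fun z => F (splice A (sample X z.1) (sample X z.2))) v ->
  hasE P (F \o sample X) v.
Proof.
move=> mF F0 [_ h]; apply: hasE_ge0.
- exact: (measurableT_comp mF (measurable_sample X)).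
- by move=> s; exact: F0.
by rewrite -h (law_splice indX A (F := fun x => (F x)%:E)) //; exact/measurable_EFinP.
Qed.

Lemma log_gap_splice (A : {set I}) (F : cyl R I -> R) c :
  measurable_fun setT F -> (forall x, 1 <= F x) ->
  log_gap (P \x P)%E c (fun z => F (splice A (sample X z.1) (sample X z.2))) ->
  log_gap P c (F \o sample X).
Proof.
move=> mF F1 [v [L [hv hL le]]]; exists v, L; split => //.
  by apply: hasE_splice hv => // x; exact: le_trans ler01 (F1 x).
apply: (@hasE_splice A (fun x => ln (F x))) hL; last by move=> x; exact: ln_ge0.
exact: (measurableT_comp (@measurable_ln R) mF).
Qed.

End transfer.

Section random_gram.
Context d (T : measurableType d) (R : realType) (P : probability T R) (m n : nat).
Variable X : 'I_m * 'I_n -> {RV P >-> R}.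
Hypothesis indX : independent_family X.
Hypothesis gX : forall p, std_gaussian P (X p).
Variables (c : 'I_m -> 'I_n -> R) (al be : R).
Hypothesis be0 : 0 < be.
Hypothesis cP : forall i j, be <= c i j <= al.

Local Notation vec := (cyl R ('I_m * 'I_n)%type).

Definition scaled (x : vec) : 'M[R]_(m, n) := \matrix_(i, j) (c i j * x (i, j)).
Definition gdet (x : vec) : R := \det (gram1 (scaled x)).
Definition vrow (i : 'I_m) : {set 'I_m * 'I_n} := [set p : 'I_m * 'I_n | p.1 == i]%SET.
Definition vbelow (k : nat) : {set 'I_m * 'I_n} := [set p : 'I_m * 'I_n | (p.1 < k)%N]%SET.
Definition zero : vec := fun=> 0.

Lemma gdet_ge1 x : 1 <= gdet x. Proof. exact: det_gram1_ge1. Qed.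

Lemma gdet_gt0 x : 0 < gdet x. Proof. exact: lt_le_trans ltr01 (gdet_ge1 x). Qed.

Lemma measurable_scaled i j : measurable_fun setT (fun x => scaled x i j).
Proof.
under eq_fun do rewrite mxE.
by apply: measurable_funM => //; exact: measurable_coord.
Qed.

Lemma measurable_gdet : measurable_fun setT gdet.
Proof.
apply: measurable_sum => s; apply: measurable_funM => //.
apply: measurable_prod => i _; rewrite /gram1.
under eq_fun do rewrite !mxE.
apply: measurable_funD => //; apply: measurable_sum => l.
under eq_fun do rewrite mxE.
by apply: measurable_funM; exact: measurable_scaled.
Qed.

Lemma measurable_splicel (A : {set 'I_m * 'I_n}) (y : vec) :
  measurable_fun setT (fun x : vec => splice A x y).
Proof.
apply: measurable_cyl => p; rewrite /splice; case: (p \in A) => //.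
exact: measurable_coord.
Qed.

(** * Resampling a single row *)

Section row.
Variables (i : 'I_m) (y : vec).
Let E0 := scaled (splice (vrow i) zero y).
Let H := invmx (gram1 E0).

(** The matrix D H D, with D the diagonal matrix of the coefficients of row i: the form r H r^T
    expressed in the unscaled variables. *)
Definition row_form j k := c i j * c i k * H j k.

Lemma row_form_sym j k : row_form j k = row_form k j.
Proof.
have e : H k j = H j k by have /matrixP/(_ j k) := tr_invgram E0; rewrite mxE.
by rewrite /row_form e [c i j * _]mulrC.
Qed.

Lemma gdet_splice_row (x : vec) :
  gdet (splice (vrow i) x y) = gdet (splice (vrow i) zero y) *
    (1 + \sum_j \sum_k row_form j k * (x (i, j) * x (i, k))).
Proof.
rewrite /gdet (@gram1_row _ _ _ _ E0 i); last 2 first.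
- by move=> l j li; rewrite !mxE /splice !inE /= (negbTE li).
- by move=> j; rewrite mxE /splice inE eqxx mulr0.
rewrite det_add_rank1 ?gram1_unit //; congr (_ * (1 + _)).
rewrite -mulmxA mxE; apply: eq_bigr => j _; rewrite [X in _ * X]mxE big_distrr /=.
apply: eq_bigr => k _; rewrite !mxE /splice !inE !eqxx /row_form -/E0 -/H.
ring.
Qed.

Lemma row_form_ge0 (x : vec) : 0 <= \sum_j \sum_k row_form j k * (x (i, j) * x (i, k)).
Proof.
have := quad_invmx_ge0 (\row_j (c i j * x (i, j))) (gram1_unit E0).
congr (_ <= _).
rewrite -mulmxA mxE; apply: eq_bigr => j _; rewrite [X in _ * X]mxE big_distrr /=.
apply: eq_bigr => k _; rewrite !mxE /row_form -/E0 -/H; ring.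
Qed.

Lemma gdet_row_mono (x : vec) : gdet (splice (vrow i) zero y) <= gdet (splice (vrow i) x y).
Proof.
rewrite [leRHS]gdet_splice_row; apply: ler_peMr; first exact/ltW/gdet_gt0.
by rewrite lerDl row_form_ge0.
Qed.

Let Xi j : {RV P >-> R} := X (i, j).

Let indXi : independent_family Xi.
Proof.
apply: (indep_reindex (indep_mutual indX)); last by move=> j; rewrite inE.
by move=> j k [].
Qed.

Let gXi j : std_gaussian P (Xi j). Proof. exact: gX. Qed.

Let quad_ge0 s : 0 <= quad Xi row_form s.
Proof. exact: (row_form_ge0 (sample X s)). Qed.

Let mu := 1 + \sum_j row_form j j.

Lemma gdet_splice_quad s : gdet (splice (vrow i) (sample X s) y) =
  gdet (splice (vrow i) zero y) * (1 + quad Xi row_form s).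
Proof. exact: gdet_splice_row. Qed.

Lemma hasE_gdet_row :
  hasE P (fun s => gdet (splice (vrow i) (sample X s) y))
    (gdet (splice (vrow i) zero y) * mu).
Proof.
apply: eq_hasE (hasEZ _ (hasE_1quad indXi gXi row_form)) => s.
by rewrite gdet_splice_quad.
Qed.

Lemma row_mean_le : mu <= 1 + al ^+ 2 * n%:R.
Proof.
rewrite /mu lerD2l -[n in n%:R]card_ord -sum1_card natr_sum big_distrr /=.
apply: ler_sum => j _; rewrite mulr1 /row_form -expr2.
have /andP[cb ca] := cP i j.
have := invgram_diag_le1 E0 j; have := invgram_diag_ge0 E0 j; rewrite -/H => h0 h1.
have c0 : 0 <= c i j by exact: le_trans (ltW be0) cb.
have : c i j ^+ 2 <= al ^+ 2.
  by apply: lerXn2r => //; rewrite nnegrE // (le_trans c0).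
by have := sqr_ge0 (c i j); nra.
Qed.

Lemma gdet_row_bound : gdet (splice (vrow i) zero y) * mu <=
  (1 + al ^+ 2 * n%:R) * gdet (splice (vrow i) zero y).
Proof. by rewrite mulrC ler_pM2r ?gdet_gt0 // row_mean_le. Qed.

(** The squared Frobenius norm of [row_form] is at most al^4 tr H, because the squared entries in
    row j of H sum to at most [H j j], while the mean is at least be^2 tr H: the relative variance
    is O(1 / tr H). *)
Lemma row_log_gap (q : R) : 0 < q -> q <= \tr H ->
  log_gap P ((2 + 4 * ln (1 + al ^+ 2 * n%:R)) *
     (wick_const R * (al ^+ 4 / (be ^+ 4 * q))))
   (fun s => gdet (splice (vrow i) (sample X s) y)).
Proof.
move=> q0 qH; have g0 := gdet_gt0 (splice (vrow i) zero y).
have mu1 : 1 <= mu by exact: (quad_mean_ge1 indXi gXi quad_ge0).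
have mu0 : 0 < mu by exact: lt_le_trans ltr01 mu1.
have [L [hL le]] := ln_quad_gap indXi gXi row_form_sym quad_ge0.
exists (gdet (splice (vrow i) zero y) * mu), (ln (gdet (splice (vrow i) zero y)) + L).
split; first exact: hasE_gdet_row.
  apply: eq_hasE (hasED (hasE_cst P _) hL) => s.
  rewrite gdet_splice_quad lnM ?posrE //; have := quad_ge0 s; lra.
rewrite lnM ?posrE // addrCA lerD2l; apply: le_trans le _; rewrite lerD2r.
have lmu0 := ln_ge0 mu1.
have lmu : ln mu <= ln (1 + al ^+ 2 * n%:R).
  by rewrite ler_ln ?posrE ?row_mean_le //; apply: lt_le_trans mu0 row_mean_le.
have H0 j : 0 <= H j j by exact: invgram_diag_ge0.
have tr0 : 0 < \tr H by exact: lt_le_trans q0 qH.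
have al0 : 0 <= al.
  case: (posnP n) => [n0|n0].
    by move: tr0; rewrite /mxtrace big1 ?ltxx // => j; exfalso; have := ltn_ord j; lia.
  by have /andP[h1 h2] := cP i (Ordinal n0); apply: le_trans (ltW be0) (le_trans h1 h2).
have c0 j : 0 <= c i j by have /andP[h1 _] := cP i j; exact: le_trans (ltW be0) h1.
have V : \sum_j \sum_k row_form j k ^+ 2 <= al ^+ 4 * \tr H.
  rewrite /mxtrace big_distrr /=; apply: ler_sum => j _.
  apply: le_trans (ler_wpM2l (exprn_ge0 4 al0) (invgram_row_sqr E0 j)).
  rewrite big_distrr /=; apply: ler_sum => k _; rewrite /row_form exprMn ler_wpM2r ?sqr_ge0 //.
  rewrite (_ : al ^+ 4 = (al * al) ^+ 2); last by ring.
  apply: lerXn2r; rewrite ?nnegrE ?mulr_ge0 //.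
  by apply: ler_pM => //; [have /andP[] := cP i j|have /andP[] := cP i k].
have mutr : be ^+ 2 * \tr H <= mu.
  rewrite /mu /mxtrace big_distrr /= -[leLHS]add0r; apply: lerD => //.
  apply: ler_sum => j _; rewrite /row_form ler_wpM2r //.
  rewrite -expr2; apply: lerXn2r; rewrite ?nnegrE //; first exact: ltW.
  by have /andP[] := cP i j.
have bt0 : 0 < be ^+ 2 * \tr H by rewrite mulr_gt0 // exprn_gt0.
have frac : (\sum_j \sum_k row_form j k ^+ 2) / mu ^+ 2 <= al ^+ 4 / (be ^+ 4 * q).
  apply: (@le_trans _ _ (al ^+ 4 * \tr H / (be ^+ 2 * \tr H) ^+ 2)).
    apply: ler_pM => //.
    - by apply: sumr_ge0 => j _; apply: sumr_ge0 => k _; exact: sqr_ge0.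
    - by rewrite invr_ge0 exprn_ge0 // ltW.
    rewrite lef_pV2 ?posrE ?exprn_gt0 //.
    by apply: lerXn2r; rewrite ?nnegrE // ltW.
  rewrite (_ : al ^+ 4 * \tr H / (be ^+ 2 * \tr H) ^+ 2 =
    al ^+ 4 / (be ^+ 4 * \tr H)); last first.
    by field; rewrite !gt_eqF.
  apply: ler_wpM2l; first exact: exprn_ge0.
  by rewrite lef_pV2 ?posrE ?mulr_gt0 ?exprn_gt0 // ler_pM2l // exprn_gt0.
rewrite -[X in _ * X <= _]mulrA; apply: ler_pM.
- by rewrite addr_ge0 // mulr_ge0.
- rewrite !mulr_ge0 ?wick_const_ge0 //; last by rewrite invr_ge0 exprn_ge0 // ltW.
  by apply: sumr_ge0 => j _; apply: sumr_ge0 => k _; exact: sqr_ge0.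
- by rewrite lerD2l ler_pM2l.
- by apply: ler_wpM2l => //; exact: wick_const_ge0.
Qed.

(* Since tr H = n - tr(E0 H E0^T), it suffices that each row of E0 has leverage at
   most 1, and a zero row has leverage 0. *)
Lemma trace_row_ge (m' : nat) : (i < m')%N ->
  (forall p : 'I_m * 'I_n, (m' <= p.1)%N -> y p = 0) ->
  (m' <= n)%N -> (n - m').+1%:R <= \tr H.
Proof.
move=> im' y0 m'n; apply: le_trans (trace_invgram_ge E0).
have count := sum_ltn_le m m'.
(* The extra 1 is row [i]: it is among the first m' rows but vanishes in [E0]. This is the successor
   in the bound. *)
have : \sum_l (row l E0 != 0)%:R + 1 <= (m'%:R : R).
  rewrite -natr_sum natr1 ler_nat; apply: leq_trans count.
  rewrite (bigD1 i) //= [in leqRHS](bigD1 i) //= im'.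
  have -> : row i E0 == 0.
    by apply/eqP/rowP => j; rewrite !mxE /splice inE eqxx mulr0.
  rewrite add0n add1n ltnS; apply: leq_sum => l li.
  case: (ltnP l m') => lm; first by case: (_ != _).
  rewrite (_ : row l E0 = 0) ?eqxx //.
  by apply/rowP => j; rewrite !mxE /splice inE /= (negbTE li) y0 ?mulr0.
rewrite -natr1 natrB //; lra.
Qed.

End row.

(** * Adding the rows one at a time *)

Lemma splice_vbelow0 (x y : vec) : splice (vbelow 0) x y = y.
Proof. by apply/funext => p; rewrite /splice inE. Qed.

Lemma splice_vbelow_all (x y : vec) : splice (vbelow m) x y = x.
Proof. by apply/funext => p; rewrite /splice inE ltn_ord. Qed.

Lemma splice_vbelowS (i : 'I_m) (x y : vec) :
  splice (vbelow i.+1) x y = splice (vrow i) x (splice (vbelow i) x y).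
Proof.
apply/funext => p; rewrite /splice !inE ltnS leq_eqVlt -(inj_eq val_inj).
by case: eqP.
Qed.

Lemma splice_vbelow_splice (i : 'I_m) (x x' y : vec) :
  splice (vbelow i.+1) (splice (vbelow i) x x') y =
  splice (vrow i) x' (splice (vbelow i) x y).
Proof.
apply/funext => p; rewrite /splice !inE ltnS leq_eqVlt -(inj_eq val_inj).
case: eqP => [->|_] /=; first by rewrite ltnn.
by case: (p.1 < i)%N.
Qed.

Lemma splice_vrow_vbelow (i : 'I_m) (x x' y : vec) :
  splice (vrow i) x' (splice (vbelow i) x y) =
  splice (vbelow i) x (splice (vrow i) x' y).
Proof.
apply/funext => p; rewrite /splice !inE -(inj_eq val_inj).
case: eqP => [->|_] /=; first by rewrite ltnn.
by case: (p.1 < i)%N.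
Qed.

Local Notation Lam := (1 + al ^+ 2 * n%:R).

Lemma Lam_ge1 : 1 <= Lam.
Proof. by rewrite lerDl mulr_ge0 // sqr_ge0. Qed.

Lemma Lam_gt0 : 0 < Lam.
Proof. exact: lt_le_trans ltr01 Lam_ge1. Qed.

(** The first factor supplies the rows before i, the second supplies row i, and [y] the rows after
    it. *)
Let g (i : 'I_m) (y : vec) (z : T * T) :=
  gdet (splice (vbelow i.+1) (splice (vbelow i) (sample X z.1) (sample X z.2)) y).

(* Each new row multiplies the mean by at most [Lam], whatever the remaining rows;
   this gives integrability, and handles the last rows, where [tr H] may be small. *)
Lemma hasE_next_row (i : 'I_m) (y : vec) w :
  hasE P (fun s => gdet (splice (vbelow i) (sample X s) (splice (vrow i) zero y))) w ->
  exists v, hasE (P \x P)%E (g i y) v /\ v <= Lam * w.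
Proof.
move=> hw; apply: (hasE_prod_bound _ _ (hasEZ Lam hw)) => [|z|s].
- apply: (measurableT_comp measurable_gdet).
  exact: (measurableT_comp (measurable_splicel _ _) (measurable_splice X _)).
- exact: le_trans ler01 (gdet_ge1 _).
rewrite -splice_vrow_vbelow.
exists (gdet (splice (vrow i) zero (splice (vbelow i) (sample X s) y)) *
  (1 + \sum_j row_form i (splice (vbelow i) (sample X s) y) j j)).
split; last exact: gdet_row_bound.
by apply: eq_hasE (hasE_gdet_row _ _) => s'; rewrite /g splice_vbelow_splice.
Qed.

Definition row_gap_const (q : R) :=
  (2 + 4 * ln Lam) * (wick_const R * (al ^+ 4 / (be ^+ 4 * q))).

(** The induction keeps an arbitrary filling [y] of the remaining rows, since [log_gap_prod] asks
    for the gap of the first k rows at every value of row k. That [y] vanishes from row m' on keeps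
    the trace bound available throughout. *)
Lemma gdet_log_gap_head (m' k : nat) : (m' <= n)%N -> (k <= m')%N -> (m' <= m)%N ->
  forall y : vec, (forall p : 'I_m * 'I_n, (m' <= p.1)%N -> y p = 0) ->
  log_gap P (k%:R * row_gap_const (n - m').+1%:R)
    (fun s => gdet (splice (vbelow k) (sample X s) y)).
Proof.
move=> m'n; elim: k => [|k IH] km' m'm y y0.
  exists (gdet y), (ln (gdet y)); rewrite mul0r add0r; split => //.
    by apply: eq_hasE (hasE_cst P _) => s; rewrite splice_vbelow0.
  by apply: eq_hasE (hasE_cst P _) => s; rewrite splice_vbelow0.
have km : (k < m)%N by exact: leq_trans m'm.
pose i := Ordinal km.
have row0 (x' : vec) (p : 'I_m * 'I_n) : (m' <= p.1)%N -> splice (vrow i) x' y p = 0.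
  move=> mp; rewrite /splice inE; case: eqP => [e|_]; last exact: y0.
  by move: mp; rewrite e /= leqNgt km'.
have IHk := IH (ltnW km') m'm.
(* The mean with row k zeroed is finite, and [hasE_next_row] then gives integrability with row k
   random. *)
have [w [L [hw _ _]]] := IHk _ (row0 zero).
have [v [hv _]] := @hasE_next_row i y w hw.
have -> : k.+1%:R * row_gap_const (n - m').+1%:R =
    k%:R * row_gap_const (n - m').+1%:R + row_gap_const (n - m').+1%:R.
  by rewrite -natr1 mulrDl mul1r.
apply: (@log_gap_splice _ _ _ P _ X indX (vbelow k)
   (fun x => gdet (splice (vbelow k.+1) x y))).
- exact: (measurableT_comp measurable_gdet (measurable_splicel _ _)).
- by move=> x; exact: gdet_ge1.
apply: (log_gap_prod _ _ _ hv) => [z|s'|s]; first exact: gdet_ge1.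
- have [w' [L' [h1 h2 h3]]] := IHk _ (row0 (sample X s')).
  exists w', L'; split; last exact: h3.
    by apply: eq_hasE h1 => s; rewrite /g (splice_vbelow_splice i) splice_vrow_vbelow.
  by apply: eq_hasE h2 => s; rewrite /g (splice_vbelow_splice i) splice_vrow_vbelow.
have tr : (n - m').+1%:R <= \tr (invmx (gram1 (scaled
    (splice (vrow i) zero (splice (vbelow k) (sample X s) y))))).
  apply: trace_row_ge => // p mp; rewrite /splice inE y0 //.
  by rewrite ltnNge (leq_trans (ltnW km')).
have [w' [L' [h1 h2 h3]]] := row_log_gap (ltr0Sn R _) tr.
exists w', L'; split; last exact: h3.
  by apply: eq_hasE h1 => s'; rewrite /g (splice_vbelow_splice i).
by apply: eq_hasE h2 => s'; rewrite /g (splice_vbelow_splice i).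
Qed.

Lemma gdet_log_gap (m' : nat) : (m' <= n)%N -> (m' <= m)%N ->
  log_gap P (m'%:R * row_gap_const (n - m').+1%:R + (m - m')%:R * ln Lam)
    (fun s => gdet (sample X s)).
Proof.
move=> m'n m'm.
have step k : (m' <= k)%N -> (k <= m)%N ->
    log_gap P (m'%:R * row_gap_const (n - m').+1%:R + (k - m')%:R * ln Lam)
      (fun s => gdet (splice (vbelow k) (sample X s) zero)).
  elim: k => [|k IH] m'k km.
    have := @gdet_log_gap_head m' 0 m'n (leq0n _) m'm zero (fun _ _ => erefl).
    by move: m'k; rewrite leqn0 => /eqP ->; rewrite !mul0r addr0.
  (* At k + 1 = m' the first m' rows are complete and the head bound starts the induction; every
     later row costs one [ln Lam]. *)
  have [e|m'k1] := eqVneq m' k.+1.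
    by rewrite -e subnn mul0r addr0; apply: gdet_log_gap_head.
  have m'k' : (m' <= k)%N by rewrite -ltnS ltn_neqAle m'k1.
  pose i := Ordinal km.
  have [w [L [hw hL le]]] := IH m'k' (ltnW km).
  have z0 (x : vec) : splice (vbelow k) x (splice (vrow i) zero zero) = splice (vbelow k) x zero.
    by apply/funext => p; rewrite /splice !if_same.
  have hw' : hasE P (fun s =>
      gdet (splice (vbelow i) (sample X s) (splice (vrow i) zero zero))) w.
    by apply: eq_hasE hw => s; rewrite z0.
  have [v [hv vw]] := hasE_next_row hw'.
  have hv' := @hasE_splice _ _ _ P _ X indX (vbelow k)
    (fun x => gdet (splice (vbelow k.+1) x zero)) v
    (measurableT_comp measurable_gdet (measurable_splicel _ _))
    (fun x => le_trans ler01 (gdet_ge1 _)) hv.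
  have [L' hL'] := hasE_ln hv' (fun s => gdet_ge1 _).
  exists v, L'; split => //.
  have LL' : L <= L'.
    apply: (hasE_le hL hL') => s; rewrite ler_ln ?posrE ?gdet_gt0 //.
    rewrite /= (splice_vbelowS i); set x := sample X s.
    apply: le_trans (gdet_row_mono i _ x).
    rewrite (_ : splice (vrow i) zero _ = splice (vbelow k) x zero) //.
    by rewrite splice_vrow_vbelow z0.
  have v0 : 0 < v.
    apply: lt_le_trans ltr01 _.
    by apply: (hasE_le (hasE_cst P 1) hv') => s; exact: gdet_ge1.
  have w0 : 0 < w.
    apply: lt_le_trans ltr01 _.
    by apply: (hasE_le (hasE_cst P 1) hw) => s; exact: gdet_ge1.
  have : ln v <= ln Lam + ln w.
    by rewrite -lnM ?posrE ?Lam_gt0 // ler_ln ?posrE // mulr_gt0 ?Lam_gt0.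
  by rewrite subSn // -[(k - m').+1%:R]natr1 mulrDl mul1r; lra.
have [v [L [h1 h2 h3]]] := step m m'm (leqnn m).
exists v, L; split; last exact: h3.
  by apply: eq_hasE h1 => s; rewrite splice_vbelow_all.
by apply: eq_hasE h2 => s; rewrite splice_vbelow_all.
Qed.

End random_gram.

(** * Matchings and the expected determinant *)

Section matchings.
Local Close Scope classical_set_scope.
Context (R : comPzRingType) (V : finType).
Implicit Types (D M : {set {set V}}) (w : {set V} -> R).

Definition matching M : bool :=
  [forall e in M, forall f in M, (e != f) ==> [disjoint e & f]].

Lemma matchingP M : reflect (forall e f, e \in M -> f \in M -> e != f -> [disjoint e & f])
  (matching M).
Proof.
apply: (iffP forall_inP) => [h e f eM fM ef|h e eM].
  by have /forall_inP/(_ f fM)/implyP/(_ ef) := h e eM.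
by apply/forall_inP => f fM; apply/implyP; exact: h.
Qed.

Definition matching_sum w D : R :=
  \sum_(M : {set {set V}} | (M \subset D) && matching M) \prod_(e in M) w e.

(** Removing [e] is a bijection onto the matchings by edges disjoint from [e]. A nonempty [e] is not
    disjoint from itself, so it cannot be among those edges. *)
Lemma matching_sum_edge w D (e : {set V}) : e \in D -> e != finset.set0 ->
  \sum_(M : {set {set V}} | ((M \subset D) && matching M) && (e \in M)) \prod_(f in M) w f =
  w e * matching_sum w [set f in D | [disjoint f & e]].
Proof.
move=> eD /finset.set0Pn[v ve]; rewrite /matching_sum big_distrr /=.
have nd : ~~ [disjoint e & e].
  by rewrite -finset.setI_eq0 finset.setIid; apply/finset.set0Pn; exists v.
have nin M : M \subset [set f in D | [disjoint f & e]] -> e \notin M.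
  by move=> /fintype.subsetP s; apply/negP => /s; rewrite inE (negbTE nd) andbF.
rewrite (reindex_onto (fun M => e |: M)%SET (fun M => M :\ e)%SET) /=; last first.
  by move=> M /andP[_ eM]; rewrite finset.setD1K.
apply: eq_big => [M|M /andP[/andP[/andP[sM mM] eM] /eqP eq]].
  apply/idP/idP => [/andP[/andP[/andP[sM mM] _] /eqP eq]|/andP[sM mM]].
    have eM : e \notin M by rewrite -eq !inE eqxx.
    apply/andP; split.
      apply/fintype.subsetP => f fM; rewrite inE; have fe : f != e by apply: contraNneq eM => <-.
      rewrite (fintype.subsetP sM) ?inE ?fM ?orbT //=.
      by apply: (matchingP _ mM) => //; rewrite !inE ?fM ?eqxx ?orbT.
    apply/matchingP => f g fM gM; apply: (matchingP _ mM); by rewrite !inE ?fM ?gM orbT.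
  have eM := nin M sM; rewrite finset.setU11 andbT.
  rewrite finset.setU1K // eqxx andbT; apply/andP; split.
    apply/fintype.subsetP => f; rewrite !inE => /orP[/eqP -> //|fM].
    by have := fintype.subsetP sM f fM; rewrite inE => /andP[].
  have dj f : f \in M -> [disjoint f & e] by move=> /(fintype.subsetP sM); rewrite inE => /andP[].
  apply/matchingP => f g; rewrite !inE => /orP[/eqP ->|fM] /orP[/eqP ->|gM] fg.
  - by rewrite eqxx in fg.
  - by rewrite disjoint_sym dj.
  - exact: dj.
  - exact: (matchingP _ mM).
have eM' : e \notin M by rewrite -eq !inE eqxx.
by rewrite big_setU1.
Qed.

(** A matching either misses [v] or contains exactly one edge through it, as two such edges would
    meet. *)
Lemma matching_sum_vertex w D (v : V) :
  matching_sum w D = matching_sum w [set e in D | v \notin e]%SET +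
    \sum_(e in D | v \in e) w e * matching_sum w [set f in D | [disjoint f & e]].
Proof.
have h e : e \in D -> v \in e -> w e * matching_sum w [set f in D | [disjoint f & e]] =
    \sum_(M : {set {set V}} | (M \subset D) && matching M)
      (if e \in M then \prod_(f in M) w f else 0).
  move=> eD ve; rewrite -matching_sum_edge //; last by apply/finset.set0Pn; exists v.
  by rewrite -big_mkcondr.
rewrite (eq_bigr (fun e => \sum_(M : {set {set V}} | (M \subset D) && matching M)
   (if e \in M then \prod_(f in M) w f else 0))); last by move=> e /andP[]; exact: h.
rewrite exchange_big /=.
have -> : matching_sum w [set e in D | v \notin e]%SET =
    \sum_(M : {set {set V}} | (M \subset D) && matching M)
      (if [forall e in M, v \notin e] then \prod_(f in M) w f else 0).
  rewrite -big_mkcondr; apply: eq_bigl => M.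
  apply/andP/andP => [[sM mM]|[/andP[sM mM] /forall_inP nM]].
    split; [apply/andP; split => //|].
      by apply/fintype.subsetP => e /(fintype.subsetP sM); rewrite inE => /andP[].
    by apply/forall_inP => e /(fintype.subsetP sM); rewrite inE => /andP[].
  split=> //; apply/fintype.subsetP => e eM; rewrite inE (fintype.subsetP sM) //=; exact: nM.
rewrite -big_split /=; apply: eq_bigr => M /andP[sM mM].
case: forall_inP => [nM|/forall_inP].
  rewrite [X in _ + X]big1 ?addr0 // => e /andP[_ ve]; case: ifP => // eM.
  by move: (nM e eM); rewrite ve.
rewrite negb_forall_in => /exists_inP[e eM]; rewrite negbK => ve.
rewrite add0r [RHS](bigD1 e) /=; last by rewrite (fintype.subsetP sM).
rewrite eM [X in _ + X]big1 ?addr0 // => f /andP[/andP[fD vf] fe]; case: ifP => // fM.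
have := matchingP _ mM _ _ fM eM fe.
by rewrite -finset.setI_eq0 => /eqP/finset.setP/(_ v); rewrite !inE vf ve.
Qed.

End matchings.

Section bipartite.
Local Close Scope classical_set_scope.
Context (R : realType) (m n : nat).
Implicit Types (w : {set 'I_(m + n)} -> R) (B : {set 'I_n}).

Definition edge (i : 'I_m) (j : 'I_n) : {set 'I_(m + n)} := [set lshift n i; rshift m j]%SET.

(** [B] holds the column vertices still available, so that matching a row vertex removes one element
    of [B]. *)
Definition edges_below (k : nat) B : {set {set 'I_(m + n)}} :=
  [set edge p.1 p.2 | p : 'I_m * 'I_n in
    [set p : 'I_m * 'I_n | (p.1 < k)%N && (p.2 \in B)]%SET]%SET.

Lemma lshift_edge i i' j : (lshift n i \in edge i' j) = (i == i').
Proof. by rewrite !inE eq_lshift eq_lrshift orbF. Qed.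

Lemma rshift_edge j i j' : (rshift m j \in edge i j') = (j == j').
Proof. by rewrite !inE eq_rlshift eq_rshift. Qed.

Lemma edge_inj i j i' j' : edge i j = edge i' j' -> i = i' /\ j = j'.
Proof.
move=> e; split; apply/eqP.
  by rewrite -(lshift_edge _ _ j') -e lshift_edge eqxx.
by rewrite -(rshift_edge _ i' _) -e rshift_edge eqxx.
Qed.

Lemma disjoint_edge i j i' j' : [disjoint edge i j & edge i' j'] = (i != i') && (j != j').
Proof.
rewrite -finset.setI_eq0; apply/eqP/andP => [h|[ii jj]].
  split; apply/negP => /eqP e.
    by move/finset.setP/(_ (lshift n i)): h; rewrite finset.in_setI !lshift_edge e eqxx inE.
  by move/finset.setP/(_ (rshift m j)): h; rewrite finset.in_setI !rshift_edge e eqxx inE.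
apply/finset.setP => v; rewrite finset.in_setI [RHS]inE; case: (split_ordP v) => u ->.
  by rewrite !lshift_edge; apply/negP => /andP[/eqP -> ]; apply/negP.
by rewrite !rshift_edge; apply/negP => /andP[/eqP -> ]; apply/negP.
Qed.

Lemma edges_belowP k B (e : {set 'I_(m + n)}) :
  reflect (exists (i : 'I_m) (j : 'I_n), [/\ (i < k)%N, j \in B & e = edge i j])
  (e \in edges_below k B).
Proof.
apply: (iffP imsetP) => [[[i j]]|[i [j [ik jB ->]]]].
  by rewrite inE /= => /andP[ik jB] ->; exists i, j.
by exists (i, j) => //; rewrite inE ik jB.
Qed.

Lemma mem_edge k B i j : (edge i j \in edges_below k B) = (i < k)%N && (j \in B).
Proof.
apply/edges_belowP/andP => [[i' [j' [ik jB /edge_inj[-> ->]]]] //|[ik jB]].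
by exists i, j.
Qed.

Lemma matching_sum_row w (i : 'I_m) B :
  matching_sum w (edges_below i.+1 B) = matching_sum w (edges_below i B) +
    \sum_(j in B) w (edge i j) * matching_sum w (edges_below i (B :\ j)).
Proof.
rewrite (matching_sum_vertex _ _ (lshift n i)).
have e1 : [set e in edges_below i.+1 B | lshift n i \notin e]%SET = edges_below i B.
  apply/finset.setP => e; rewrite inE; apply/andP/edges_belowP.
    move=> [/edges_belowP[i' [j [ik jB ->]]]]; rewrite lshift_edge => ne.
    exists i', j; split => //; rewrite ltn_neqAle -ltnS ik andbT.
    by apply: contra ne => /eqP /val_inj ->.
  move=> [i' [j [ik jB ->]]]; have ii : i != i' by apply/eqP => ei; rewrite ei ltnn in ik.
  by rewrite mem_edge jB lshift_edge ii (ltn_trans ik (ltnSn i)).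
rewrite e1; congr (_ + _).
transitivity (\sum_(e in [set edge i j | j in B]%SET)
    w e * matching_sum w [set f in edges_below i.+1 B | [disjoint f & e]]%SET).
  apply: eq_bigl => e; apply/andP/imsetP.
    move=> [/edges_belowP[i' [j [ik jB ->]]]]; rewrite lshift_edge => /eqP <-.
    by exists j.
  by move=> [j jB ->]; rewrite mem_edge jB ltnSn lshift_edge eqxx.
rewrite big_imset /=; last by move=> j j' _ _ /edge_inj[].
apply: eq_bigr => j jB; congr (_ * matching_sum w _).
apply/finset.setP => e; rewrite inE; apply/andP/edges_belowP.
  move=> [/edges_belowP[i' [j' [ik jB' ->]]]]; rewrite disjoint_edge => /andP[ii jj].
  exists i', j'; split => //; last by rewrite !inE jj.
  by rewrite ltn_neqAle -ltnS ik andbT; exact: ii.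
move=> [i' [j' [ik]]]; rewrite !inE => /andP[jj jB'] ->.
have ii : i' != i by apply/eqP => e'; rewrite e' ltnn in ik.
by rewrite mem_edge jB' disjoint_edge ii jj (ltn_trans ik (ltnSn i)).
Qed.

Lemma matching_sum0 w B : matching_sum w (edges_below 0 B) = 1.
Proof.
have -> : edges_below 0 B = finset.set0.
  by apply/finset.setP => e; rewrite inE; apply/negP => /edges_belowP[? [? []]].
rewrite /matching_sum (big_pred1 finset.set0) ?big_set0 // => M.
rewrite finset.subset0; apply/andP/eqP => [[/eqP ->] //|->]; split => //.
by apply/matchingP => e f; rewrite inE.
Qed.

(* This turns the mean of 1 + r H r^T into the vertex recursion of the matching sum:
   det B * (B^-1) j j is the determinant after deletion of the column vertex j. *)
Lemma cofactor_mask (c : 'I_m -> 'I_n -> R) (E E' : 'M[R]_(m, n)) (j : 'I_n) :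
  (forall l k, E' l k = if k == j then 0 else E l k) ->
  \det (gram1 E) * invmx (gram1 E) j j = \det (gram1 E').
Proof.
move=> hE.
have -> : \det (gram1 E) * invmx (gram1 E) j j = cofactor (gram1 E) j j.
  rewrite /invmx gram1_unit !mxE mulrA divff ?mul1r //.
  by rewrite gt_eqF // (lt_le_trans ltr01) // det_gram1_ge1.
(* Column j of [E'] is zero, so [gram1 E'] agrees with the identity in row and column j, and its
   determinant is the minor of [gram1 E]. *)
have g' k l : gram1 E' k l =
    if (k == j) || (l == j) then (k == l)%:R else gram1 E k l.
  rewrite !mxE; case: (eqVneq k j) => [->|kj] /=.
    by rewrite big1 ?addr0 // => p _; rewrite !mxE hE eqxx mul0r.
  case: (eqVneq l j) => [->|lj].
    by rewrite big1 ?addr0 // => p _; rewrite !mxE !hE eqxx mulr0.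
  by congr (_ + _); apply: eq_bigr => p _; rewrite !mxE !hE (negbTE kj) (negbTE lj).
rewrite (expand_det_row _ j) (bigD1 j) //= g' !eqxx mul1r big1 ?addr0; last first.
  by move=> k kj; rewrite g' eqxx /= [j == k]eq_sym (negbTE kj) mul0r.
have nl k : (lift j k == j) = false by rewrite eq_sym; exact/negbTE/neq_lift.
have minor : row' j (col' j (gram1 E')) = row' j (col' j (gram1 E)).
  by apply/matrixP => k l; rewrite ![row' _ _ _ _]mxE ![col' _ _ _ _]mxE g' !nl.
by rewrite /cofactor minor.
Qed.

End bipartite.

Lemma hasE_prod d1 d2 (T1 : measurableType d1) (T2 : measurableType d2)
    (R : realType) (P : probability T1 R) (Q : probability T2 R)
    (g : T1 * T2 -> R) (f : T1 -> R) (w : R) :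
  measurable_fun setT g -> (forall z, 0 <= g z) -> hasE P f w ->
  (forall x, hasE Q (fun y => g (x, y)) (f x)) ->
  hasE (P \x Q)%E g w.
Proof.
move=> mg g0 Ef h; apply: hasE_ge0 => //.
have mgE : measurable_fun setT (fun z => (g z)%:E) by exact/measurable_EFinP.
have gE0 z : (0 <= (g z)%:E)%E by rewrite lee_fin.
rewrite (fubini_tonelli1 _ mgE gE0) -Ef.2; apply: eq_integral => x _.
by rewrite /fubini_F (h x).2.
Qed.

Section expected_gram.
Context d (T : measurableType d) (R : realType) (P : probability T R) (m n : nat).
Variable X : 'I_m * 'I_n -> {RV P >-> R}.
Hypothesis indX : independent_family X.
Hypothesis gX : forall p, std_gaussian P (X p).
Variables (c : 'I_m -> 'I_n -> R) (w : {set 'I_(m + n)} -> R).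
Hypothesis wE : forall i j, w (edge i j) = c i j ^+ 2.

(** Deletes column vertices by zeroing their coefficients, which keeps the size of the matrices
    fixed. *)
Definition masked (B : {set 'I_n}) i j := if j \in B then c i j else 0.

Let vec := cyl R ('I_m * 'I_n)%type.
Let z0 : vec := @zero R m n.

Lemma gdet_masked_row (B : {set 'I_n}) (i : 'I_m) (y : vec) :
  gdet (masked B) y * (1 + \sum_j row_form (masked B) i y j j) =
  gdet (masked B) y +
    \sum_(j in B) c i j ^+ 2 * (gdet (masked B) y *
       invmx (gram1 (scaled (masked B) (splice (@vrow m n i) z0 y))) j j).
Proof.
rewrite mulrDr mulr1 big_distrr /=; congr (_ + _).
rewrite [RHS]big_mkcond /=; apply: eq_bigr => j _.
rewrite /row_form /masked; case: ifP => _; last by rewrite mul0r mul0r mulr0.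
by rewrite -expr2 mulrCA.
Qed.

Lemma gdet_masked_col (B : {set 'I_n}) (y : vec) (j : 'I_n) :
  gdet (masked B) y * invmx (gram1 (scaled (masked B) y)) j j =
  gdet (masked (B :\ j)%SET) y.
Proof.
apply: cofactor_mask => // l k; rewrite !mxE /masked in_setD1.
by case: eqVneq => //=; rewrite mul0r.
Qed.

(** Integrating out row k reproduces the expansion of the matching sum at that row vertex. The
    masked determinants that appear are covered by induction because [B] is arbitrary. *)
Lemma hasE_gdet_below (k : nat) : (k <= m)%N -> forall B : {set 'I_n},
  hasE P (fun s => gdet (masked B) (splice (@vbelow m n k) (sample X s) z0))
    (matching_sum w (edges_below m k B)).
Proof.
elim: k => [|k IH] km B.
  rewrite matching_sum0; apply: eq_hasE (hasE_cst P 1) => s.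
  rewrite splice_vbelow0 /gdet /gram1 (_ : scaled _ _ = 0) ?mulmx0 ?addr0 ?det1 //.
  by apply/matrixP => i j; rewrite !mxE mulr0.
pose i := Ordinal km.
rewrite -[k.+1]/(i.+1) matching_sum_row.
apply: (@hasE_splice _ _ _ P _ X indX (@vbelow m n k)
    (fun x => gdet (masked B) (splice (@vbelow m n i.+1) x z0))).
- exact: (measurableT_comp (measurable_gdet _) (measurable_splicel _ _)).
- by move=> x; exact: le_trans ler01 (gdet_ge1 _ _).
have IHk := IH (ltnW km).
pose f s := gdet (masked B) (splice (@vbelow m n k) (sample X s) z0) +
  \sum_(j in B) c i j ^+ 2 * gdet (masked (B :\ j)%SET) (splice (@vbelow m n k) (sample X s) z0).
have hf : hasE P f (matching_sum w (edges_below m i B) +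
    \sum_(j in B) w (edge i j) * matching_sum w (edges_below m i (B :\ j))).
  apply: hasED; first exact: IHk.
  by apply: hasE_sum => j _; rewrite wE; apply: hasEZ; exact: IHk.
apply: (hasE_prod _ _ hf) => [|z|s].
- apply: (measurableT_comp (measurable_gdet _)).
  exact: (measurableT_comp (measurable_splicel _ _) (measurable_splice X _)).
- exact: le_trans ler01 (gdet_ge1 _ _).
have rz : splice (@vrow m n i) z0 (splice (@vbelow m n k) (sample X s) z0) =
    splice (@vbelow m n k) (sample X s) z0.
  by rewrite splice_vrow_vbelow; congr splice; apply/funext => p; rewrite /splice if_same.
rewrite (_ : f s = gdet (masked B)
    (splice (@vrow m n i) z0 (splice (@vbelow m n k) (sample X s) z0)) *
   (1 + \sum_j row_form (masked B) i (splice (@vbelow m n k) (sample X s) z0) j j)).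
  apply: eq_hasE (hasE_gdet_row indX gX _ _ _) => s'.
  by rewrite (splice_vbelow_splice i).
rewrite rz gdet_masked_row rz /f; congr (_ + _); apply: eq_bigr => j _.
by rewrite gdet_masked_col.
Qed.

Lemma hasE_gdet : hasE P (fun s => gdet c (sample X s))
  (matching_sum w (edges_below m m finset.setT)).
Proof.
apply: eq_hasE (hasE_gdet_below (leqnn m) finset.setT) => s.
rewrite splice_vbelow_all /gdet (_ : scaled (masked _) _ = scaled c (sample X s)) //.
by apply/matrixP => i j; rewrite !mxE /masked inE.
Qed.

End expected_gram.

Section Phi.
Context (R : realType) (m n : nat).
Variables (t : R) (omega : 'I_m -> 'I_n -> R).
Hypothesis t0 : 0 < t.

Lemma Kbip_weight i j : wg_weight (Kbip omega) (edge i j) = omega i j.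
Proof.
rewrite /= (bigD1 i) //= (bigD1 j) //= eqxx !big1 ?addr0 //.
  move=> i' ii; rewrite big1 // => j' _; case: eqP => // /(@edge_inj m n)[e _].
  by rewrite e eqxx in ii.
by move=> j' jj; case: eqP => // /(@edge_inj m n)[_ e]; rewrite e eqxx in jj.
Qed.

Lemma Kbip_edges : wg_edges (Kbip omega) = edges_below m m finset.setT.
Proof.
apply/finset.setP => e; apply/imset2P/edges_belowP => [[i j _ _ ->]|[i [j [_ _ ->]]]].
  by exists i, j; rewrite ltn_ord inE.
by exists i j.
Qed.

(** This makes [inord] faithful on sizes of matchings when the sum is partitioned below. *)
Lemma card_matching_le (M : {set {set 'I_(m + n)}}) :
  M \subset wg_edges (Kbip omega) -> matching M -> (#|M| <= (m + n)./2)%N.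
Proof.
move=> /fintype.subsetP sM /matchingP mM.
have tM : finset.trivIset M by apply/finset.trivIsetP => e f eM fM; exact: mM.
have : (#|finset.cover M| <= m + n)%N.
  by rewrite -[X in (_ <= X)%N]card_ord; exact: max_card.
rewrite -(eqP tM) (eq_bigr (fun=> 2)) => [|e /sM]; last first.
  by rewrite Kbip_edges => /edges_belowP[i [j [_ _ ->]]]; rewrite cards2 eq_lrshift.
by rewrite sum_nat_const => h; lia.
Qed.

(** Group the matchings by size k: the k factors 1/t lower the exponent of t by k. *)
Lemma Phi_match_matching_sum : Phi_match t (Kbip omega) =
  t ^+ (m + n)./2 * matching_sum (fun e => wg_weight (Kbip omega) e / t)
     (edges_below m m finset.setT).
Proof.
set G := Kbip omega; rewrite /matching_sum big_distrr /=.
rewrite (partition_big (fun M : {set {set 'I_(m + n)}} => inord #|M| : 'I_((m + n)./2).+1)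
  xpredT) //=.
apply: eq_bigr => k _; rewrite /phi_match big_distrl /=.
have cM (M : {set {set 'I_(m + n)}}) : M \subset wg_edges G ->
    matching M -> (inord #|M| == k) = (#|M| == k :> nat).
  move=> sM mM; rewrite -(inj_eq val_inj) /= inordK // ltnS.
  exact: card_matching_le.
apply: eq_big => [M|M].
  rewrite /is_kmatching -Kbip_edges -/G -/(matching M).
  have [sM|] := boolP (M \subset wg_edges G); last by rewrite andFb.
  have [mM|] := boolP (matching M); last by rewrite andbF.
  by rewrite cM // andbT.
move=> /and3P[sM /eqP cMk _]; rewrite prodf_div [X in _ / X](eq_bigr (fun=> t)) //.
rewrite prodr_const cMk mulrCA; congr (_ * _).
have kle : (k <= (m + n)./2)%N by rewrite -ltnS.
by apply: (canRL (mulfK _)); rewrite ?expf_neq0 ?gt_eqF // -exprD subnK.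
Qed.

End Phi.

(** * Asymptotics *)

Section det_YA.
Context (R : realType) (m n : nat) (t : R) (omega : 'I_m -> 'I_n -> R).
Hypothesis t0 : 0 < t.
Let tau := Num.sqrt t.

Definition coef (i : 'I_m) (j : 'I_n) : R := Num.sqrt (omega i j) / tau.

Lemma det_block_gram1 (E : 'M[R]_(m, n)) :
  \det (block_mx 1%:M E (- E^T) 1%:M) = \det (gram1 E).
Proof.
have <- : \det (block_mx 1%:M E (- E^T) 1%:M *m block_mx 1%:M (- E) 0 1%:M) =
    \det (block_mx 1%:M E (- E^T) 1%:M).
  by rewrite det_mulmx det_ublock !det1 !mulr1.
rewrite mulmx_block !mulmx0 !mulmx1 !mul1mx !addr0 addNr det_lblock det1 mul1r.
by rewrite mulNmx mulmxN opprK addrC.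
Qed.

(** The diagonal blocks of [Amat] vanish, and both other blocks read [x] at the same pair, since row
    vertices precede column vertices. Each of the m + n rows then releases a factor [tau]. *)
Lemma det_YA (x : 'I_(m + n) -> 'I_(m + n) -> R) :
  \det (tau%:M + Ymat (Amat omega) x) =
  tau ^+ (m + n) * gdet coef (fun p => x (lshift n p.1) (rshift m p.2)).
Proof.
have tau0 : tau != 0 by rewrite gt_eqF // sqrtr_gt0.
rewrite /gdet -det_block_gram1 -detZ; congr (\det _).
apply/matrixP => u v.
have -> : (tau%:M + Ymat (Amat omega) x) u v =
    tau *+ (u == v) + Amat omega u v * (if (u <= v)%N then x u v else x v u).
  by rewrite mxE [X in X + _]mxE [X in _ + X]mxE.
rewrite [RHS]mxE /Amat.
case: (split_ordP u) => i ->; case: (split_ordP v) => j ->.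
- by rewrite !block_mxEul !mxE mul0r addr0 eq_lshift mulr_natr.
- rewrite !block_mxEur !mxE eq_lrshift add0r /= ifT; last by have := ltn_ord i; lia.
  by rewrite /coef -/tau mulrA mulrCA divff ?mulr1 // mulrC.
- rewrite !block_mxEdl !mxE eq_rlshift add0r /= ifF; last by have := ltn_ord j; lia.
  by rewrite /coef -/tau mulrN mulNr mulrA mulrCA divff ?mulr1 // mulrC.
- by rewrite !block_mxEdr !mxE mul0r addr0 eq_rshift mulr_natr.
Qed.
End det_YA.

Lemma nat_sqrt_exists (n : nat) : exists k, (k ^ 2 <= n < k.+1 ^ 2)%N.
Proof.
elim: n => [|n [k /andP[h1 h2]]]; first by exists 0%N.
have [h|h] := leqP (k.+1 ^ 2) n.+1.
  by exists k.+1; rewrite h /=; move: h2; rewrite -!mulnn; nia.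
by exists k; rewrite h andbT; apply: leq_trans h1 (leqnSn n).
Qed.

(** A fourth root suffices: about sqrt n rows at cost n^(1/4) each give n^(3/4) = o(n). *)
Lemma ln_le_fourth_root (R : realType) (y h : R) : 0 < y -> 0 <= h -> y <= h ^+ 4 ->
  ln y <= 4 * h.
Proof.
move=> y0 h0 yh; have h1 : 0 < h.
  by rewrite lt0r h0 andbT; apply: contraTneq yh => ->; rewrite expr0n /= -ltNge.
apply: (@le_trans _ _ (ln (h ^+ 4))); first by rewrite ler_ln ?posrE // exprn_gt0.
rewrite lnXn // -[_ *+ 4]mulr_natl ler_pM2l //; exact/ltW/ln_sublinear.
Qed.

(** With k the integer square root of n and h = sqrt(k + 1), of order n^(1/4), the logarithm is O(h)
    and each of the three terms is O(n / h). *)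
Lemma gap_asymptotics (R : realType) (al be K eps : R) :
  0 < be -> 0 <= al -> 0 <= K -> 0 < eps ->
  exists n0 : nat, forall n m : nat, (n0 <= n)%N -> (m <= n)%N ->
  exists m', [/\ (m' <= m)%N, (m' <= n)%N &
    m'%:R * row_gap_const n al be (n - m').+1%:R +
    (m - m')%:R * ln (1 + al ^+ 2 * n%:R) + K <= eps * (m + n)%:R].
Proof.
move=> be0 al0 K0 eps0.
pose C := wick_const R * (al ^+ 4 / be ^+ 4).
have C0 : 0 <= C by rewrite mulr_ge0 ?wick_const_ge0 // divr_ge0 // exprn_ge0 // ltW.
pose kap := 1 + al.
have kap1 : 1 <= kap by rewrite /kap lerDl.
(* The sum of the constants of [part1], [part2] and [part3]; [n0] is chosen to force B / h <=
   eps. *)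
pose B := (2 + 16 * kap) * C + 16 * kap + 4 * K.
have B0 : 0 <= B by rewrite /B; nra.
pose n0 := (Num.truncn ((B / eps) ^+ 4)).+1.
exists n0 => n m nn mn.
have [k /andP[k1 k2]] := nat_sqrt_exists n.
(* The subtraction is truncated: for m <= k every row is treated as one of the last rows. *)
exists (m - k)%N; split; [exact: leq_subr|exact: leq_trans (leq_subr _ _) mn|].
have n1 : (1 <= n)%N by exact: leq_trans nn.
have kpos : (1 <= k)%N by move: k2; case: (k) => //; lia.
pose s : R := k.+1%:R; pose h := Num.sqrt s.
have s0 : 0 < s by rewrite ltr0Sn.
have h0 : 0 < h by rewrite sqrtr_gt0.
have hs : h ^+ 2 = s by rewrite sqr_sqrtr // ltW.
have h4 : h ^+ 4 = s ^+ 2 by rewrite -hs -exprM.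
have nlt : n%:R < h ^+ 4 by rewrite h4 -natrX ltr_nat.
have s2 : 2 <= s by rewrite /s ler_nat.
have nge : h ^+ 4 / 4 <= n%:R.
  have : (k%:R : R) ^+ 2 <= n%:R by rewrite -natrX ler_nat.
  have -> : k%:R = s - 1 :> R by rewrite /s -natr1 addrK.
  by rewrite h4; nra.
have h1 : 1 <= h by rewrite -sqrtr1 ler_sqrt //; lra.
have Bh : B / eps <= h.
  have : (B / eps) ^+ 4 <= h ^+ 4.
    apply: le_trans (ltW nlt); apply: (@le_trans _ _ n0%:R); last by rewrite ler_nat.
    by rewrite /n0 ltW // truncnS_gt.
  by rewrite ler_pXn2r // nnegrE; [apply: divr_ge0 => //; exact: ltW|exact: ltW].
set l := ln (1 + al ^+ 2 * n%:R).
have nR : 1 <= n%:R :> R by rewrite ler1n.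
have l0 : 0 <= l by apply: ln_ge0; rewrite lerDl mulr_ge0 // sqr_ge0.
have lh : l <= 4 * (kap * h).
  apply: ln_le_fourth_root.
  - by rewrite ltr_wpDr // mulr_ge0 // sqr_ge0.
  - by rewrite mulr_ge0 // ?ltW //; lra.
  rewrite exprMn; apply: (@le_trans _ _ (kap ^+ 2 * n%:R)).
    have an := mulr_ge0 al0 (ler0n R n).
    rewrite (_ : kap ^+ 2 * n%:R = al ^+ 2 * n%:R + 2 * (al * n%:R) + n%:R); last first.
      by rewrite /kap; ring.
    lra.
  apply: ler_pM; [exact: sqr_ge0|exact: ler0n| |exact: ltW].
  exact: ler_weXn2l.
have part2 : (m - (m - k))%:R * l <= 16 * kap * n%:R / h.
  have : (m - (m - k))%:R <= h ^+ 2 :> R.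
    by rewrite hs /s ler_nat; clear; lia.
  move=> ps; apply: le_trans (ler_pM (ler0n _ _) l0 ps lh) _.
  rewrite ler_pdivlMr //.
  have -> : h ^+ 2 * (4 * (kap * h)) * h = 16 * kap * (h ^+ 4 / 4) by field.
  by rewrite ler_wpM2l // mulr_ge0 //; lra.
have part1 : (m - k)%:R * row_gap_const n al be (n - (m - k)).+1%:R <=
    n%:R * ((2 + 16 * kap) * C) / h.
  have [mk|mk] := leqP m k.
    rewrite (eqP mk) mul0r; apply: divr_ge0; last exact: ltW.
    by rewrite mulr_ge0 ?ler0n // mulr_ge0 // addr_ge0 // mulr_ge0 // (le_trans ler01).
  rewrite -mulrA; apply: ler_pM => //.
  - rewrite /row_gap_const mulr_ge0 ?addr_ge0 ?mulr_ge0 ?wick_const_ge0 ?exprn_ge0 //.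
    by rewrite invr_ge0 mulr_ge0 // exprn_ge0 // ltW.
  - by rewrite ler_nat (leq_trans (leq_subr _ _)).
  rewrite /row_gap_const -/l.
  set q := (n - (m - k)).+1%:R.
  have qs : s <= q by rewrite /q /s ler_nat; clear -mk mn; lia.
  have q0 : 0 < q by exact: lt_le_trans s0 qs.
  have -> : wick_const R * (al ^+ 4 / (be ^+ 4 * q)) = C / q.
    by rewrite /C; field; rewrite !gt_eqF.
  apply: (@le_trans _ _ ((2 + 4 * l) * (C / s))).
    apply: ler_wpM2l; first by rewrite addr_ge0 // mulr_ge0.
    by apply: ler_wpM2l => //; rewrite lef_pV2 ?posrE.
  rewrite ler_pdivlMr //.
  have -> : (2 + 4 * l) * (C / s) * h = ((2 + 4 * l) / h) * C.
    by rewrite -hs; field; rewrite gt_eqF.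
  apply: ler_wpM2r => //; rewrite ler_pdivrMr //; nra.
have part3 : K <= 4 * K * n%:R / h.
  rewrite ler_pdivlMr // (_ : 4 * K * n%:R = K * (4 * n%:R)); last by ring.
  apply: ler_wpM2l => //.
  have : h <= h ^+ 4 by rewrite ler_eXnr.
  lra.
have : n%:R * B / h <= eps * n%:R.
  rewrite ler_pdivrMr // [eps * _]mulrC -mulrA; apply: ler_wpM2l => //.
  by rewrite mulrC -ler_pdivrMr.
have : eps * n%:R <= eps * (m + n)%:R by rewrite ler_pM2l // ler_nat leq_addl.
have : n%:R * B / h =
    n%:R * ((2 + 16 * kap) * C) / h + 16 * kap * n%:R / h + 4 * K * n%:R / h.
  by rewrite /B; field; rewrite gt_eqF.
lra.
Qed.

(** * Concentration of the log-determinant *)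

Section assembly.
Context (R : realType) (a b t : R).
Hypotheses (hb : 0 < b) (hba : b <= a) (ht : 0 < t).
Variables (m n : nat) (omega : 'I_m -> 'I_n -> R).
Hypothesis homega : forall i j, b ^+ 2 <= omega i j <= a ^+ 2.
Context (d : measure_display) (T : measurableType d) (P : probability T R).
Variable x : 'I_(m + n) -> 'I_(m + n) -> {RV P >-> R}.
Hypothesis gx : iid_std_gaussian x.
Let tau := Num.sqrt t.
Let F s := logdet_YA omega t (fun i j => x i j s).
Let c := coef t omega.
Let X (p : 'I_m * 'I_n) : {RV P >-> R} := x (lshift n p.1) (rshift m p.2).

Let tau0 : 0 < tau. Proof. by rewrite sqrtr_gt0. Qed.

Lemma lshift_le_rshift (i : 'I_m) (j : 'I_n) : (lshift n i <= rshift m j)%N.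
Proof. by rewrite /= ltnW // (leq_trans (ltn_ord i)) // leq_addr. Qed.

Let indX : independent_family X.
Proof.
have [ix _] := gx.
apply: (@indep_reindex _ _ _ P _ _ _ (fun p => x p.1 p.2)
  (fun p : 'I_m * 'I_n => (lshift n p.1, rshift m p.2)) ix).
  by move=> [i j] [i' j'] [/= e1 /addnI e2]; congr pair; exact: val_inj.
by move=> p; rewrite inE; exact: lshift_le_rshift.
Qed.

Let gX p : std_gaussian P (X p).
Proof. by have [_] := gx; apply; exact: lshift_le_rshift. Qed.

Lemma coef_bounds i j : b / tau <= c i j <= a / tau.
Proof.
have /andP[h1 h2] := homega i j; rewrite /c /coef -/tau !ler_pM2r ?invr_gt0 //.
have a0 : 0 <= a by apply: le_trans hba; exact: ltW.
have eb : b = Num.sqrt (b ^+ 2) by rewrite sqrtr_sqr ger0_norm // ltW.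
have ea : a = Num.sqrt (a ^+ 2) by rewrite sqrtr_sqr ger0_norm.
by apply/andP; split; [rewrite eb|rewrite ea]; exact: ler_wsqrtr.
Qed.

Lemma logdet_gdet s : F s = ln (tau ^+ (m + n)) + ln (gdet c (sample X s)).
Proof.
by rewrite /F /logdet_YA det_YA // lnM ?posrE ?exprn_gt0 // gdet_gt0.
Qed.

Lemma measurable_logdet : measurable_fun setT F.
Proof.
rewrite (_ : F = fun s => ln (tau ^+ (m + n)) + ln (gdet c (sample X s))).
  apply: measurable_funD => //; apply: (measurableT_comp (@measurable_ln R)).
  exact: (measurableT_comp (measurable_gdet _) (measurable_sample X)).
by apply/funext => s; exact: logdet_gdet.
Qed.

(* [r] accounts for sqrt t ^ (m+n) against t ^ (m+n)./2 when m+n is odd. *)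
Lemma logdet_vs_Phi (m' : nat) : (m' <= n)%N -> (m' <= m)%N ->
  exists U : T -> R, exists r L, [/\
    forall s, F s = ln (Phi_match t (Kbip omega)) + r + U s,
    `|r| <= `|ln tau|, hasE P U L, hasE P (fun s => expR (U s)) 1 &
    - (m'%:R * row_gap_const n (a / tau) (b / tau) (n - m').+1%:R +
      (m - m')%:R * ln (1 + (a / tau) ^+ 2 * n%:R)) <= L].
Proof.
move=> m'n m'm.
have bt0 : 0 < b / tau by rewrite divr_gt0.
have [v [L [hv hL le]]] := gdet_log_gap indX gX bt0 coef_bounds m'n m'm.
pose w e := wg_weight (Kbip omega) e / t.
have wE i j : w (edge i j) = c i j ^+ 2.
  have /andP[h1 _] := homega i j.
  rewrite /w Kbip_weight /c /coef expr_div_n !sqr_sqrtr ?ltW //.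
  by apply: lt_le_trans h1; exact: exprn_gt0.
have ev := hasE_unique hv (hasE_gdet indX gX wE).
have v0 : 0 < v.
  by apply: lt_le_trans ltr01 _; apply: (hasE_le (hasE_cst P 1) hv) => s; exact: gdet_ge1.
have lnPhi : ln (Phi_match t (Kbip omega)) = (m + n)./2%:R * ln t + ln v.
  rewrite Phi_match_matching_sum // -/w -ev lnM ?posrE ?exprn_gt0 //.
  by rewrite lnXn // mulr_natl.
have lnt : ln t = 2 * ln tau.
  by rewrite -[in LHS](sqr_sqrtr (ltW ht)) -/tau lnXn // mulr_natl.
have lntau : ln (tau ^+ (m + n)) = (m + n)./2%:R * ln t + (odd (m + n))%:R * ln tau.
  have hN : (m + n)%:R = (odd (m + n))%:R + 2 * (m + n)./2%:R :> R.
    by rewrite -{1}(odd_double_half (m + n)) natrD -mul2n natrM.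
  by rewrite lnXn // -[_ *+ (m + n)]mulr_natl hN lnt; ring.
exists (fun s => ln (gdet c (sample X s)) - ln v), ((odd (m + n))%:R * ln tau), (L - ln v).
split.
- by move=> s; rewrite logdet_gdet lntau lnPhi; ring.
- by case: (odd _); rewrite ?mul1r // mul0r normr0.
- exact: hasED hL (hasE_cst P _).
- have := hasEZ v^-1 hv; rewrite mulVf ?gt_eqF //; apply: eq_hasE => s.
  by rewrite expRB !lnK ?posrE ?gdet_gt0 // mulrC.
- lra.
Qed.

End assembly.

Lemma hasE_markov d (T : measurableType d) (R : realType) (P : probability T R)
    (W : T -> R) (w q : R) (S : set T) : measurable S -> hasE P W w ->
  (forall s, 0 <= W s) -> 0 < q -> (forall s, S s -> q <= W s) -> (P S <= (w / q)%:E)%E.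
Proof.
move=> mS hW W0 q0 SW.
have h : hasE P (fun s => q^-1 * W s) (q^-1 * w) := hasEZ _ hW.
rewrite mulrC -h.2 -[X in (X <= _)%E](_ : \int[P]_s (\1_S s)%:E = _)%E; last first.
  by rewrite integral_indic // setIT.
apply: ge0_le_integral => //.
- exact/measurable_EFinP/measurable_indic.
- exact: (measurable_int P h.1).
move=> s _; rewrite lee_fin indicE mulrC; case: (boolP (s \in S)) => [|_].
  by rewrite inE => /SW qW; rewrite ler_pdivlMr // mul1r.
by rewrite divr_ge0 // ltW.
Qed.

Theorem theorem6p1 (R : realType) (a b t : R)
    (hb : 0 < b) (hba : b <= a) (ht : 0 < t) :
  (* limsup_n sup_{m<=n, omega} Pr(|logdet - log Phi|/(m+n) > delta) = 0 *)
  (forall delta eps : R, 0 < delta -> 0 < eps ->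
    exists n0 : nat, forall n m : nat, (n0 <= n)%N -> (1 <= m <= n)%N ->
    forall omega : 'I_m -> 'I_n -> R,
      (forall i j, b ^+ 2 <= omega i j <= a ^+ 2) ->
    forall (d : measure_display) (T : measurableType d) (P : probability T R)
      (x : 'I_(m + n) -> 'I_(m + n) -> {RV P >-> R}),
      iid_std_gaussian x ->
      (P [set s | (delta < (m + n)%:R^-1 *
           `|logdet_YA omega t (fun i j => x i j s)
             - ln (Phi_match t (Kbip omega))|)%R] <= eps%:E)%E)
  /\
  (* limsup_n sup_{m<=n, omega} (log Phi - log tilde Phi)/(m+n) <= 0 *)
  (forall eps : R, 0 < eps ->
    exists n0 : nat, forall n m : nat, (n0 <= n)%N -> (1 <= m <= n)%N ->
    forall omega : 'I_m -> 'I_n -> R,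
      (forall i j, b ^+ 2 <= omega i j <= a ^+ 2) ->
    forall (d : measure_display) (T : measurableType d) (P : probability T R)
      (x : 'I_(m + n) -> 'I_(m + n) -> {RV P >-> R}),
      iid_std_gaussian x ->
      (((m + n)%:R^-1)%:E *
         ((ln (Phi_match t (Kbip omega)))%:E - logtPhi omega t x) <= eps%:E)%E)
  /\
  (* limsup_n sup_{m<=n, omega} (log Phi - log tilde Phi)/(m+n) >= 0 *)
  (forall eps : R, 0 < eps -> forall n0 : nat,
    exists n m : nat, [/\ (n0 <= n)%N, (1 <= m <= n)%N &
    exists omega : 'I_m -> 'I_n -> R,
      (forall i j, b ^+ 2 <= omega i j <= a ^+ 2) /\
    forall (d : measure_display) (T : measurableType d) (P : probability T R)
      (x : 'I_(m + n) -> 'I_(m + n) -> {RV P >-> R}),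
      iid_std_gaussian x ->
      ((- eps)%:E < ((m + n)%:R^-1)%:E *
         ((ln (Phi_match t (Kbip omega)))%:E - logtPhi omega t x))%E]).
Proof.
have a0 : 0 <= a by apply: le_trans hba; exact: ltW.
have tau0 : 0 < Num.sqrt t by rewrite sqrtr_gt0.
have be0 : 0 < b / Num.sqrt t by rewrite divr_gt0.
have al0 : 0 <= a / Num.sqrt t by rewrite divr_ge0 // ltW.
set lt := `|ln (Num.sqrt t)|.
have lt0 : 0 <= lt by exact: normr_ge0.
have Npos (m n : nat) : (1 <= m <= n)%N -> 0 < (m + n)%:R :> R.
  by move=> /andP[m1 _]; rewrite ltr0n addn_gt0 m1.
split; [|split].
- move=> delta eps delta0 eps0.
  (* The constant 2 + [lt] is what the mean of W below adds to - L; the factor [delta] anticipates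
     the division in Markov's inequality. *)
  have [|n0 hn0] := @gap_asymptotics R (a / Num.sqrt t) (b / Num.sqrt t) (2 + lt)
    (delta * eps) be0 al0 _ (mulr_gt0 delta0 eps0); first by rewrite addr_ge0.
  exists n0 => n m n0n mn omega homega d T P x gx.
  have N0 := Npos _ _ mn; have /andP[m1 mn'] := mn.
  have [m' [m'm m'n le]] := hn0 n m n0n mn'.
  have [U [r [L [FU rle hU heU Lge]]]] :=
    logdet_vs_Phi hb hba ht homega gx m'n m'm.
  rewrite -/lt in rle.
  (* W = 2 e^U - U + [lt] dominates |U| + |r|, has mean 2 - L + [lt], and is what Markov's
     inequality is applied to. *)
  have hW := hasED (hasED (hasEZ 2 heU) (hasEZ (-1) hU)) (hasE_cst P lt).
  have Uabs s : `|U s| <= 2 * expR (U s) - U s.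
    have e1 := expR_ge1Dx (U s); have e0 := expR_gt0 (U s).
    by case: (ger0P (U s)) => u; lra.
  have W0 s : 0 <= 2 * expR (U s) + -1 * U s + lt.
    by have := Uabs s; have := normr_ge0 (U s); lra.
  apply: (@le_trans _ _ ((2 * 1 + -1 * L + lt) / (delta * (m + n)%:R))%:E).
    apply: (hasE_markov _ hW W0) => [||s /=].
    + pose f s := (m + n)%:R^-1 * `|logdet_YA omega t (fun i j => x i j s)
         - ln (Phi_match t (Kbip omega))|.
      have mf : measurable_fun setT f.
        apply: measurable_funM => //; apply: measurableT_comp => //.
        by apply: measurable_funB => //; exact: measurable_logdet.
      rewrite -[mkset _]setTI; exact: (measurable_fun_ltr (measurable_cst delta) mf).
    + exact: mulr_gt0.
    rewrite FU ltr_pdivlMl // mulrC => h; apply/ltW/(lt_le_trans h).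
    rewrite (_ : _ - _ = r + U s); last by ring.
    apply: le_trans (ler_normD _ _) _; have := Uabs s; lra.
  rewrite lee_fin ler_pdivrMr ?mulr_gt0 //.
  rewrite (_ : eps * (delta * (m + n)%:R) = delta * eps * (m + n)%:R); last by ring.
  lra.
- move=> eps eps0.
  have [n0 hn0] := gap_asymptotics be0 al0 lt0 eps0.
  exists n0 => n m n0n mn omega homega d T P x gx.
  have N0 := Npos _ _ mn; have /andP[m1 mn'] := mn.
  have [m' [m'm m'n le]] := hn0 n m n0n mn'.
  have [U [r [L [FU rle hU heU Lge]]]] :=
    logdet_vs_Phi hb hba ht homega gx m'n m'm.
  rewrite -/lt in rle.
  rewrite /logtPhi; have hF := hasED (hasE_cst P (ln (Phi_match t (Kbip omega)) + r)) hU.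
  under eq_integral do rewrite FU.
  rewrite hF.2 -EFinB -EFinM lee_fin ler_pdivrMl //.
  have : - r <= `|r| by rewrite -normrN ler_norm.
  lra.
- move=> eps eps0 n0.
  (* With m = 1 and constant weights, n only has to make the parity term [lt] smaller than eps (m +
     n). *)
  pose n := (maxn n0 (Num.truncn (lt / eps))).+1.
  exists n, 1%N; split; [exact: leq_trans (leq_maxl _ _) (leqnSn _)| by []|].
  pose om (i : 'I_1) (j : 'I_n) := a ^+ 2.
  exists om.
  have homega i j : b ^+ 2 <= om i j <= a ^+ 2.
    by rewrite /om lexx andbT; apply: lerXn2r; rewrite ?nnegrE // ltW.
  split => // d T P x gx.
  have [U [r [L [FU rle hU heU _]]]] :=
    logdet_vs_Phi hb hba ht homega gx (leq0n n) (leq0n 1).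
  rewrite -/lt in rle.
  rewrite /logtPhi; have hF := hasED (hasE_cst P (ln (Phi_match t (Kbip om)) + r)) hU.
  under eq_integral do rewrite FU.
  rewrite hF.2 -EFinB -EFinM lte_fin ltr_pdivlMl ?ltr0n //.
  (* From U <= e^U - 1, whose right-hand side has mean 0. *)
  have L0 : L <= 0.
    have := hasE_le hU (hasED heU (hasE_cst P (-1))); rewrite subrr; apply => s.
    by have := expR_ge1Dx (U s); lra.
  have big : lt < eps * (1 + n)%:R.
    rewrite mulrC -ltr_pdivrMr //; apply: lt_trans (truncnS_gt _) _.
    by rewrite ltr_nat add1n !ltnS /n leq_maxr.
  have : r <= `|r| by exact: ler_norm.
  lra.
Qed.
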